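(* The safety problem of syntactically increasing networks with respect to the unordered semantics is decidable in polynomial time (PTIME).
   Context: A network is a finite undirected graph N = (H ∪ M, E, P) of hosts H and middleboxes M, with abstract packets P = H × H × T (source host, destination host, tag from a finite tag domain T); each host h can send packets from a set P_h ⊆ P. Each middlebox has ports (its adjacent edges) and a finite-state forwarding transducer: on receiving a packet on a port in its current state it (possibly nondeterministically) outputs a set of (packet, port) pairs and moves to a new state, or its transition is undefined, in which case it enters a special abort state. Middleboxes are given symbolically: the state is the valuation of finitely many relations of constant arity over finite domains (hosts, ports, tags), and the transition on an input packet (src, dst, tag, prt) is a loop-free program of guarded commands (guards are Boolean combinations of equalities and relation-membership tests; commands are output of packets, abort, insert a tuple into a relation, remove a tuple from a relation, sequential composition, and nondeterministic guarded command blocks). A symbolic middlebox is syntactically increasing if it never uses remove, uses no negated membership tests in guards, and all guards in a block are mutually exclusive; a network is syntactically increasing if all its middleboxes are. Each edge induces two directed channels of unbounded capacity; in the unordered semantics each channel holds a multiset of packets, and a middlebox may process any pending packet from any of its ingress channels in any order, while hosts may send their packets at any time. The safety problem asks whether no configuration in which some middlebox is in the abort state is reachable from the initial configuration (empty channels, initial middlebox states). Complexity is measured in the number of hosts, tags, ports, middleboxes and the size of the symbolic middlebox representations. *)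

(* Defs.v *)
From HB Require Import structures.
From mathcomp Require Import all_boot.

Set Implicit Arguments.
Unset Strict Implicit.
Unset Printing Implicit Defensive.

(** * Deterministic multi-tape Turing machines and polynomial time *)

Inductive direction := MoveLeft | Stay | MoveRight.

(* A cell is blank ([None]), an input bit or an auxiliary work symbol. *)
Definition cell (G : Type) : Type := option (bool + G).

(* [verdict q = Some b] means that [q] is a halting state with answer [b]. *)
Record TM := MkTM {
  last_tape : nat;
  work_symbol : finType;
  control : finType;
  start : control;
  verdict : control -> option bool;
  delta : control -> {ffun 'I_last_tape.+1 -> cell work_symbol} ->
          control * {ffun 'I_last_tape.+1 -> cell work_symbol * direction}
}.

(* A two-way infinite tape; both lists are read from the head outwards and are
   implicitly continued by blanks. *)
Record tape (G : Type) := Tape {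
  to_left : seq (cell G);
  scanned : cell G;
  to_right : seq (cell G)
}.

Definition tape_of (G : Type) (s : seq (cell G)) : tape G :=
  Tape [::] (head None s) (behead s).

Definition write_move (G : Type) (a : cell G * direction) (t : tape G) : tape G :=
  let: Tape l _ r := t in
  match a.2 with
  | MoveLeft => Tape (behead l) (head None l) (a.1 :: r)
  | Stay => Tape l a.1 r
  | MoveRight => Tape (a.1 :: l) (head None r) (behead r)
  end.

Definition tm_config (M : TM) : Type :=
  (control M * {ffun 'I_(last_tape M).+1 -> tape (work_symbol M)})%type.

Definition tm_init (M : TM) (w : seq bool) : tm_config M :=
  (start M,
   [ffun i => tape_of (if i == ord0 then [seq Some (inl b) | b <- w] else [::])]).

Definition tm_step (M : TM) (c : tm_config M) : tm_config M :=
  if verdict c.1 is Some _ then c else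
  let a := delta c.1 [ffun i => scanned (c.2 i)] in
  (a.1, [ffun i => write_move (a.2 i) (c.2 i)]).

Definition tm_answer (M : TM) (w : seq bool) (t : nat) : option bool :=
  verdict (iter t (@tm_step M) (tm_init M w)).1.

(* The decision problem whose instances are the [x] with [inst x], presented to
   the machine as [code x], and whose yes-instances are those with [yes x]. *)
Definition PTIME_decidable (I : Type) (code : I -> seq bool)
    (inst yes : I -> Prop) : Prop :=
  exists (M : TM) (c d : nat), forall x : I, inst x ->
    exists b : bool,
      tm_answer M (code x) (c * size (code x) ^ d + c) = Some b /\
      (b = true <-> yes x).

(** * Symbolic middleboxes *)

Inductive sort := Host | Port | Tag.

Section Middlebox.

Variables (nH nT : nat) (Pt : finType).

Definition packet : finType := ('I_nH * 'I_nH * 'I_nT)%type.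

Definition dom (s : sort) : finType :=
  match s with Host => 'I_nH | Port => Pt | Tag => 'I_nT end.

Fixpoint tuples (sg : seq sort) : finType :=
  if sg is s :: sg' then (dom s * tuples sg')%type else unit.

Inductive term : sort -> Type :=
| Src : term Host
| Dst : term Host
| Tg : term Tag
| Prt : term Port
| Const (s : sort) : dom s -> term s.

Fixpoint args (sg : seq sort) : Type :=
  if sg is s :: sg' then (term s * args sg')%type else unit.

Section Programs.

Variables (nR : nat) (sig : 'I_nR -> seq sort).

Inductive guard :=
| GEq (s : sort) of term s & term s
| GMem (r : 'I_nR) of args (sig r)
| GNot of guard
| GAnd of guard & guard
| GOr of guard & guard.

Inductive command :=
| Output of seq (term Host * term Host * term Tag * term Port)
| Abort
| Insert (r : 'I_nR) of args (sig r)
| Remove (r : 'I_nR) of args (sig r)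
| Seq of command & command
| Block of seq (guard * command).

(* A valuation of the relations, as the set of facts "tuple t is in relation r". *)
Definition fact : finType := {r : 'I_nR & tuples (sig r)}.
Definition valuation : finType := {set fact}.

Definition eval_term (x : packet * Pt) (s : sort) (t : term s) : dom s :=
  match t in term s return dom s with
  | Src => x.1.1.1
  | Dst => x.1.1.2
  | Tg => x.1.2
  | Prt => x.2
  | Const s d => d
  end.

Fixpoint eval_args (x : packet * Pt) (sg : seq sort) : args sg -> tuples sg :=
  match sg return args sg -> tuples sg with
  | [::] => fun _ => tt
  | s :: sg' => fun a => (eval_term x a.1, eval_args x a.2)
  end.

Definition eval_fact (x : packet * Pt) (r : 'I_nR) (a : args (sig r)) : fact :=
  Tagged (fun r => tuples (sig r)) (eval_args x a).

Definition eval_out (x : packet * Pt)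
    (o : term Host * term Host * term Tag * term Port) : packet * Pt :=
  (eval_term x o.1.1.1, eval_term x o.1.1.2, eval_term x o.1.2,
   eval_term x o.2).

Fixpoint holds (x : packet * Pt) (q : valuation) (g : guard) : bool :=
  match g with
  | GEq s t1 t2 => eval_term x t1 == eval_term x t2
  | GMem r a => eval_fact x a \in q
  | GNot g1 => ~~ holds x q g1
  | GAnd g1 g2 => holds x q g1 && holds x q g2
  | GOr g1 g2 => holds x q g1 || holds x q g2
  end.

(* [exec x c (q, o) r]: on input [x], starting with relations [q] and with the
   set [o] of (packet, port) pairs already output, [c] may end with result [r],
   where [None] stands for abort. A block none of whose guards holds has no
   effect. *)
Inductive exec (x : packet * Pt) : command ->
    valuation * {set packet * Pt} -> option (valuation * {set packet * Pt}) ->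
    Prop :=
| ExecOutput os q o :
    exec x (Output os) (q, o)
      (Some (q, o :|: [set y in [seq eval_out x w | w <- os]]))
| ExecAbort s : exec x Abort s None
| ExecInsert r (a : args (sig r)) q o :
    exec x (Insert a) (q, o) (Some (eval_fact x a |: q, o))
| ExecRemove r (a : args (sig r)) q o :
    exec x (Remove a) (q, o) (Some (q :\ eval_fact x a, o))
| ExecSeq c1 c2 s s' res :
    exec x c1 s (Some s') -> exec x c2 s' res -> exec x (Seq c1 c2) s res
| ExecSeqAbort c1 c2 s :
    exec x c1 s None -> exec x (Seq c1 c2) s None
| ExecBlock gcs i g c s res :
    onth gcs i = Some (g, c) -> holds x s.1 g -> exec x c s res ->
    exec x (Block gcs) s res
| ExecBlockSkip gcs s :
    all (fun gc => ~~ holds x s.1 gc.1) gcs -> exec x (Block gcs) s (Some s).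

(* [mem_polarity b g]: every membership test of [g] is under an even number of
   negations if [b], under an odd number otherwise. *)
Fixpoint mem_polarity (b : bool) (g : guard) : bool :=
  match g with
  | GEq _ _ _ => true
  | GMem _ _ => b
  | GNot g1 => mem_polarity (~~ b) g1
  | GAnd g1 g2 | GOr g1 g2 => mem_polarity b g1 && mem_polarity b g2
  end.

Definition no_negated_mem (g : guard) : bool := mem_polarity true g.

Definition mutually_exclusive (gs : seq guard) : Prop :=
  forall (x : packet * Pt) (q : valuation), count (holds x q) gs <= 1.

Fixpoint increasing_command (c : command) : Prop :=
  match c with
  | Output _ | Abort | Insert _ _ => True
  | Remove _ _ => False
  | Seq c1 c2 => increasing_command c1 /\ increasing_command c2
  | Block gcs =>
      mutually_exclusive [seq gc.1 | gc <- gcs] /\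
      foldr (fun gc P =>
        [/\ no_negated_mem gc.1, increasing_command gc.2 & P]) True gcs
  end.

End Programs.

Record middlebox := MkMiddlebox {
  nrel : nat;
  signature : 'I_nrel -> seq sort;
  program : command signature;
  initial : valuation signature
}.

Definition mstate (m : middlebox) : finType := valuation (@signature m).

End Middlebox.

(** * Networks and their unordered semantics *)

(* The graph is simple, so a port of middlebox [m] (an edge adjacent to [m]) is
   given by the neighbour of [m] at its other end. *)
Record network := MkNetwork {
  hosts : nat;
  tags : nat;
  mboxes : nat;
  adj : rel ('I_hosts + 'I_mboxes);
  adj_sym : symmetric adj;
  adj_irr : irreflexive adj;
  sendable : 'I_hosts -> {set packet hosts tags};
  mbox : forall m : 'I_mboxes,
    middlebox hosts tags {v : 'I_hosts + 'I_mboxes | adj (inr m) v}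
}.

Definition syntactically_increasing (N : network) : Prop :=
  forall m : 'I_(mboxes N), increasing_command (program (mbox m)).

Definition arity_at_most (k : nat) (N : network) : Prop :=
  forall (m : 'I_(mboxes N)) (r : 'I_(nrel (mbox m))),
    size (signature r) <= k.

Section Semantics.

Variable N : network.

Definition node : finType := ('I_(hosts N) + 'I_(mboxes N))%type.
Definition pkt : finType := packet (hosts N) (tags N).
Definition port (m : 'I_(mboxes N)) : finType := {v : node | adj (inr m) v}.

(* [c (u, v, p)] is the number of copies of [p] pending on the channel from [u]
   to [v]. *)
Definition channels : Type := {ffun node * node * pkt -> nat}.

(* The state [None] is abort. *)
Definition mstates : Type :=
  forall m : 'I_(mboxes N), option (mstate (mbox m)).

Definition config : Type := (channels * mstates)%type.

Definition init_config : config := ([ffun _ => 0], fun m => Some (initial (mbox m))).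

Definition enqueue (c : channels) (A : {set node * node * pkt}) : channels :=
  [ffun y => c y + (y \in A)].

Definition dequeue (c : channels) (z : node * node * pkt) : channels :=
  [ffun y => c y - (y == z)].

Definition egress (m : 'I_(mboxes N)) (o : {set pkt * port m}) :
    {set node * node * pkt} :=
  [set (inr m : node, val y.2, y.1) | y in o].

Definition set_mstate (s : mstates) (m : 'I_(mboxes N))
    (q : option (mstate (mbox m))) : mstates :=
  dfwith s q.

Inductive step : config -> config -> Prop :=
| StepSend (c : channels) (s : mstates) (h : 'I_(hosts N)) (v : node) (p : pkt) :
    adj (inl h) v -> p \in sendable h ->
    step (c, s) (enqueue c [set (inl h : node, v, p)], s)
| StepProcess (c : channels) (s : mstates) (m : 'I_(mboxes N)) (v : port m)
    (p : pkt) (q q' : mstate (mbox m)) (o : {set pkt * port m}) :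
    s m = Some q -> 0 < c (val v, inr m, p) ->
    exec (p, v) (program (mbox m)) (q, set0) (Some (q', o)) ->
    step (c, s)
      (enqueue (dequeue c (val v, inr m, p)) (egress o), set_mstate s (Some q'))
| StepAbort (c : channels) (s : mstates) (m : 'I_(mboxes N)) (v : port m)
    (p : pkt) (q : mstate (mbox m)) :
    s m = Some q -> 0 < c (val v, inr m, p) ->
    exec (p, v) (program (mbox m)) (q, set0) None ->
    step (c, s) (dequeue c (val v, inr m, p), set_mstate s (None : option (mstate (mbox m)))).

Inductive reachable : config -> Prop :=
| ReachInit : reachable init_config
| ReachStep c c' : reachable c -> step c c' -> reachable c'.

Definition safe : Prop :=
  forall c : config, reachable c -> forall m : 'I_(mboxes N), c.2 m <> None.

End Semantics.

(** * Encoding of networks as bit strings *)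

(* Networks are first written as binary trees (S-expressions), with numbers in
   unary, and trees are then written in prefix notation. *)
Inductive tree := Leaf | Cons of tree & tree.

Fixpoint bits (t : tree) : seq bool :=
  if t is Cons t1 t2 then true :: bits t1 ++ bits t2 else [:: false].

Definition tnat (n : nat) : tree := iter n (Cons Leaf) Leaf.

Definition tseq (A : Type) (f : A -> tree) (s : seq A) : tree :=
  foldr (fun a => Cons (f a)) Leaf s.

Definition tlist (s : seq tree) : tree := tseq id s.

Definition tsort (s : sort) : tree :=
  tnat (match s with Host => 0 | Port => 1 | Tag => 2 end).

Definition tpacket (nH nT : nat) (p : packet nH nT) : tree :=
  tlist [:: tnat p.1.1; tnat p.1.2; tnat p.2].

Section EncodeMiddlebox.

Variables (nH nT : nat) (Pt : finType) (tport : Pt -> tree).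

Definition tdom (s : sort) : dom nH nT Pt s -> tree :=
  match s return dom nH nT Pt s -> tree with
  | Host => fun h : 'I_nH => tnat h
  | Port => tport
  | Tag => fun t : 'I_nT => tnat t
  end.

Fixpoint ttuple (sg : seq sort) : tuples nH nT Pt sg -> tree :=
  match sg return tuples nH nT Pt sg -> tree with
  | [::] => fun _ => Leaf
  | s :: sg' => fun t => Cons (tdom t.1) (ttuple t.2)
  end.

Definition tterm (s : sort) (t : term nH nT Pt s) : tree :=
  match t with
  | Src => tlist [:: tnat 0]
  | Dst => tlist [:: tnat 1]
  | Tg => tlist [:: tnat 2]
  | Prt => tlist [:: tnat 3]
  | Const s d => tlist [:: tnat 4; tsort s; tdom d]
  end.

Fixpoint targs (sg : seq sort) : args nH nT Pt sg -> tree :=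
  match sg return args nH nT Pt sg -> tree with
  | [::] => fun _ => Leaf
  | s :: sg' => fun a => Cons (tterm a.1) (targs a.2)
  end.

Section EncodeProgram.

Variables (nR : nat) (sig : 'I_nR -> seq sort).

Fixpoint tguard (g : guard nH nT Pt sig) : tree :=
  match g with
  | GEq s t1 t2 => tlist [:: tnat 0; tterm t1; tterm t2]
  | GMem r a => tlist [:: tnat 1; tnat r; targs a]
  | GNot g1 => tlist [:: tnat 2; tguard g1]
  | GAnd g1 g2 => tlist [:: tnat 3; tguard g1; tguard g2]
  | GOr g1 g2 => tlist [:: tnat 4; tguard g1; tguard g2]
  end.

Definition tout
    (o : term nH nT Pt Host * term nH nT Pt Host * term nH nT Pt Tag *
         term nH nT Pt Port) : tree :=
  tlist [:: tterm o.1.1.1; tterm o.1.1.2; tterm o.1.2; tterm o.2].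

Fixpoint tcommand (c : command nH nT Pt sig) : tree :=
  match c with
  | Output os => tlist [:: tnat 0; tseq tout os]
  | Abort => tlist [:: tnat 1]
  | Insert r a => tlist [:: tnat 2; tnat r; targs a]
  | Remove r a => tlist [:: tnat 3; tnat r; targs a]
  | Seq c1 c2 => tlist [:: tnat 4; tcommand c1; tcommand c2]
  | Block gcs =>
      tlist [:: tnat 5; tseq (fun gc => Cons (tguard gc.1) (tcommand gc.2)) gcs]
  end.

Definition tfact (f : fact nH nT Pt sig) : tree :=
  Cons (tnat (tag f)) (ttuple (tagged f)).

End EncodeProgram.

Definition tmiddlebox (m : middlebox nH nT Pt) : tree :=
  tlist [:: tseq (fun r => tseq tsort (signature r)) (enum 'I_(nrel m));
            tcommand (program m);
            tseq (@tfact _ _) (enum (initial m))].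

End EncodeMiddlebox.

Definition tnode (N : network) (v : node N) : tree :=
  match v with
  | inl h => Cons (tnat 0) (tnat h)
  | inr m => Cons (tnat 1) (tnat m)
  end.

Definition tnetwork (N : network) : tree :=
  tlist [:: tnat (hosts N); tnat (tags N); tnat (mboxes N);
            tseq (fun e : node N * node N => Cons (tnode e.1) (tnode e.2))
              (enum [set e : node N * node N | adj e.1 e.2]);
            tseq (fun h => tseq (@tpacket _ _) (enum (sendable h)))
              (enum 'I_(hosts N));
            tseq (fun m => tmiddlebox (fun v : port m => tnode (val v)) (mbox m))
              (enum 'I_(mboxes N))].

Definition encode (N : network) : seq bool := bits (tnetwork N).

(* Main.v *)
(** Middleboxes are increasing, so an execution can be replayed from any reachable
    configuration with at least the same effects unless it aborts. Hence multiplicities do not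
    matter: the items "fact [f] of middlebox [m]", "packet [p] on channel [(u, v)]" and "abort"
    that can ever arise form the least set closed under running each program on each available
    packet with guards evaluated against the facts in the set, and the network is safe iff abort
    is not in it. There are polynomially many items when arities are bounded, so adding one item
    at a time reaches the closure in polynomial time.

    To obtain a Turing machine, four tapes are used as stacks; the first holds a stack of trees in
    prefix notation, on which [Cons] is a single push. The functions on trees computed on top of
    this stack in polynomial time contain the constructors and destructors and are closed under
    composition, conditionals, loops and structural recursion with polynomially bounded values;
    the closure algorithm is written with these operations. *)
Require Import Defs.
From mathcomp Require Import all_boot zify.
Import Defs.

Set Implicit Arguments.
Unset Strict Implicit.
Unset Printing Implicit Defensive.

(** * Stack programs on four-tape machines *)

(** The half that refutes safety argues by contradiction: assuming safety, all generated items are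
    realised together in a single reachable configuration, so abort cannot be among them. Processing
    a packet consumes it, so a run is replayed on top of itself to gain a spare copy of everything.
    Guards can be evaluated against the whole known set, regardless of the order inside a program,
    because true guards stay true when relations grow and a block entered instead of skipped can
    only add effects or abort. On the machine side the obstacle is the growth of values: iterating a
    polynomial step can build exponentially large trees, so every loop and recursion needs size
    bounds on its intermediate values. For the saturation loop such bounds are available only on
    encodings of admissible networks; this is why polynomial time is stated relative to a predicate
    on inputs. *)

Notation tapes := {ffun 'I_4 -> tape unit}.
Notation reads := {ffun 'I_4 -> cell unit}.
Notation moves := {ffun 'I_4 -> cell unit * direction}.

Definition scan (T : tapes) : reads := [ffun i => scanned (T i)].
Definition act (a : moves) (T : tapes) : tapes :=
  [ffun i => write_move (a i) (T i)].
Definition keep (r : reads) : moves := [ffun i => (r i, Stay)].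

Lemma act_keep T : act (keep (scan T)) T = T.
Proof. by apply/ffunP => i; rewrite !ffunE; case: (T i). Qed.

(** A successor [None] leaves the fragment, so fragments compose without naming exit states; the
    moves of the exiting step are still carried out. *)
Record frag := Frag {
  fctl : finType;
  fentry : fctl;
  fdelta : fctl -> reads -> option fctl * moves
}.

Inductive runs (F : frag) : fctl F -> tapes -> nat -> tapes -> Prop :=
| runs_exit q T a :
    fdelta q (scan T) = (None, a) -> runs q T 1 (act a T)
| runs_next q q' T a n T' :
    fdelta q (scan T) = (Some q', a) -> runs q' (act a T) n T' ->
    runs q T n.+1 T'.

Definition fatom (a : reads -> moves) : frag :=
  @Frag unit tt (fun _ r => (None, a r)).

Definition fseq (F G : frag) : frag :=
  @Frag (fctl F + fctl G)%type (inl (fentry F))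
    (fun q r => match q with
     | inl q => let: (o, a) := fdelta q r in
                (Some (if o is Some q' then inl q' else inr (fentry G)), a)
     | inr q => let: (o, a) := fdelta q r in (omap inr o, a)
     end).

Definition fif (sel : reads -> bool) (F G : frag) : frag :=
  @Frag (option (fctl F + fctl G)) None
    (fun q r => match q with
     | None => (Some (Some (if sel r then inl (fentry F) else inr (fentry G))),
                keep r)
     | Some (inl q) => let: (o, a) := fdelta q r in
                       (omap (fun q => Some (inl q)) o, a)
     | Some (inr q) => let: (o, a) := fdelta q r in
                       (omap (fun q => Some (inr q)) o, a)
     end).

Definition fwhile (sel : reads -> bool) (F : frag) : frag :=
  @Frag (option (fctl F)) None
    (fun q r => match q with
     | None => (if sel r then Some (Some (fentry F)) else None, keep r)
     | Some q => let: (o, a) := fdelta q r in (Some o, a)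
     end).

Lemma runs_atom a T : @runs (fatom a) tt T 1 (act (a (scan T)) T).
Proof. exact: runs_exit. Qed.

Lemma runs_seqr F G q T n T' :
  runs q T n T' -> @runs (fseq F G) (inr q) T n T'.
Proof.
elim=> {q T n T'} [q T a E|q q' T a n T' E _ IH]; first by apply: runs_exit; rewrite /= E.
by apply: runs_next IH; rewrite /= E.
Qed.

Lemma runs_seq F G q T n T' n' T'' :
  runs q T n T' -> runs (fentry G) T' n' T'' ->
  @runs (fseq F G) (inl q) T (n + n') T''.
Proof.
elim=> {q T n T'} [q T a E|q q' T a n T' E _ IH] H.
  by apply: runs_next (runs_seqr F H); rewrite /= E.
by apply: runs_next (IH H); rewrite /= E.
Qed.

Lemma runs_if_true (sel : reads -> bool) F G T n T' :
  sel (scan T) -> runs (fentry F) T n T' -> @runs (fif sel F G) None T n.+1 T'.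
Proof.
move=> s H; apply: runs_next; first by rewrite /= s.
rewrite act_keep.
elim: H => {s T n T'} [q T a E|q q' T a n T' E _ IH]; first by apply: runs_exit; rewrite /= E.
by apply: runs_next IH; rewrite /= E.
Qed.

Lemma runs_if_false (sel : reads -> bool) F G T n T' :
  sel (scan T) = false -> runs (fentry G) T n T' ->
  @runs (fif sel F G) None T n.+1 T'.
Proof.
move=> s H; apply: runs_next; first by rewrite /= s.
rewrite act_keep.
elim: H => {s T n T'} [q T a E|q q' T a n T' E _ IH]; first by apply: runs_exit; rewrite /= E.
by apply: runs_next IH; rewrite /= E.
Qed.

Lemma runs_while_exit (sel : reads -> bool) F T :
  sel (scan T) = false -> @runs (fwhile sel F) None T 1 T.
Proof.
by move=> s; rewrite -[X in runs _ _ _ X]act_keep; apply: runs_exit; rewrite /= s.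
Qed.

Lemma runs_while_next (sel : reads -> bool) F T n T' n' T'' :
  sel (scan T) -> runs (fentry F) T n T' ->
  @runs (fwhile sel F) None T' n' T'' ->
  @runs (fwhile sel F) None T (n + n').+1 T''.
Proof.
move=> s H H'; apply: runs_next; first by rewrite /= s.
rewrite act_keep.
elim: H H' => {s T n T'} [q T a E|q q' T a n T' E _ IH] H'.
  by apply: runs_next H'; rewrite /= E.
by apply: runs_next (IH H'); rewrite /= E.
Qed.

(* The tape read from the head rightwards is a stack with its top under the
   head; blanks fill both ends. *)
Definition stk (t : tape unit) (s : seq bool) : Prop :=
  (forall j, nth None (scanned t :: to_right t) j =
             nth None [seq Some (inl b) : cell unit | b <- s] j) /\
  (forall j, nth None (to_left t) j = None).

Definition repr (T : tapes) (S : seq (seq bool)) : Prop :=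
  forall i : 'I_4, stk (T i) (nth [::] S i).

(** The run must succeed from every tape content representing [S], as one stack has many
    representations that differ in explicit trailing blanks. *)
Record spec (F : frag) (S S' : seq (seq bool)) (t : nat) : Prop := Spec {
  spec_run T : repr T S -> exists T' n,
    [/\ n <= t, runs (fentry F) T n T' & repr T' S']
}.

Lemma spec_le F S S' t t' : spec F S S' t -> t <= t' -> spec F S S' t'.
Proof.
move=> H le; split=> T R; have [T' [n [le' r R']]] := spec_run H R.
by exists T', n; split=> //; apply: leq_trans le.
Qed.

Lemma spec_seq F G S S' S'' t t' :
  spec F S S' t -> spec G S' S'' t' -> spec (fseq F G) S S'' (t + t').
Proof.
move=> HF HG; split=> T R; have [T' [n [le r R']]] := spec_run HF R.
have [T'' [n' [le' r' R'']]] := spec_run HG R'.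
by exists T'', (n + n'); split=> //; [apply: leq_add | apply: runs_seq r r'].
Qed.

Definition ftop (i : 'I_4) (P : option bool -> bool) (r : reads) : bool :=
  P (if r i is Some (inl b) then Some b else None).

Lemma ftop_repr T S (i : 'I_4) P :
  repr T S -> ftop i P (scan T) = P (ohead (nth [::] S i)).
Proof.
move=> R; rewrite /ftop ffunE; have [/(_ 0) /= -> _] := R i.
by case: (nth [::] S i).
Qed.

Lemma spec_if (i : 'I_4) P F G S S' t :
  (if P (ohead (nth [::] S i)) then spec F S S' t else spec G S S' t) ->
  spec (fif (ftop i P) F G) S S' t.+1.
Proof.
case E: (P _) => H; split=> T R; have [T' [n [le r R']]] := spec_run H R;
  exists T', n.+1; split=> //.
  by apply: runs_if_true r; rewrite (ftop_repr _ _ R).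
by apply: runs_if_false r; rewrite (ftop_repr _ _ R).
Qed.

Lemma spec_while_exit (i : 'I_4) P F S :
  P (ohead (nth [::] S i)) = false -> spec (fwhile (ftop i P) F) S S 1.
Proof.
move=> E; split=> T R; exists T, 1; split=> //.
by apply: runs_while_exit; rewrite (ftop_repr _ _ R).
Qed.

Lemma spec_while_next (i : 'I_4) (P : option bool -> bool) F S S' S'' t t' :
  P (ohead (nth [::] S i)) -> spec F S S' t ->
  spec (fwhile (ftop i P) F) S' S'' t' ->
  spec (fwhile (ftop i P) F) S S'' (t + t').+1.
Proof.
move=> E HF HG; split=> T R; have [T' [n [le r R']]] := spec_run HF R.
have [T'' [n' [le' r' R'']]] := spec_run HG R'.
exists T'', (n + n').+1; split=> //; first by rewrite ltnS leq_add.
by apply: runs_while_next r r'; rewrite (ftop_repr _ _ R).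
Qed.

Definition fmod (i : 'I_4) (f : cell unit -> cell unit * direction) : frag :=
  fatom (fun r => [ffun j => if j == i then f (r j) else (r j, Stay)]).

Lemma spec_mod (i : 'I_4) f S s :
  (forall t, stk t (nth [::] S i) -> stk (write_move (f (scanned t)) t) s) ->
  spec (fmod i f) S (set_nth [::] S i s) 1.
Proof.
move=> H; split=> T R; eexists _, 1; split; [by [] | exact: runs_atom |].
move=> j; rewrite /act /scan !ffunE nth_set_nth /= -[val j == val i]/(j == i).
case: eqP => [->|_]; first exact: H.
by have := R j; case: (T j).
Qed.

(** A transition writes on the cell that the head leaves. A push therefore moves left onto a blank
    and writes there in a second step; a pop erases while moving right, which keeps the left part
    blank. *)
Definition fpush (i : 'I_4) (b : bool) : frag :=
  fseq (fmod i (fun c => (c, MoveLeft))) (fmod i (fun _ => (Some (inl b), Stay))).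

Definition fpop (i : 'I_4) : frag := fmod i (fun _ => (None, MoveRight)).

Lemma spec_push (i : 'I_4) b S :
  spec (fpush i b) S (set_nth [::] S i (b :: nth [::] S i)) 2.
Proof.
split=> T R; eexists _, (1 + 1); split; [by [] | apply: runs_seq; exact: runs_atom |].
move=> j; rewrite /act /scan !ffunE nth_set_nth /= -[val j == val i]/(j == i).
case: eqP => [->|_]; last by have := R j; case: (T j).
have := R i; case: (T i) => l c r [/= H1 H2]; split=> -[|k] //=.
- by rewrite nth_behead.
- by rewrite nth_behead.
Qed.

Lemma spec_pop (i : 'I_4) S :
  spec (fpop i) S (set_nth [::] S i (behead (nth [::] S i))) 1.
Proof.
apply: spec_mod => -[l c r] [/= H1 H2]; split=> -[|k] //=.
- by rewrite -behead_map nth_behead -H1 /= nth0.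
- by rewrite -behead_map !nth_behead -H1.
Qed.

Definition i0 : 'I_4 := @Ordinal 4 0 isT.
Definition i1 : 'I_4 := @Ordinal 4 1 isT.
Definition i2 : 'I_4 := @Ordinal 4 2 isT.
Definition i3 : 'I_4 := @Ordinal 4 3 isT.

Notation ftrue := (fun o => o == Some true).
Notation fnonempty := (fun o : option bool => o : bool).

Definition fnop : frag := fatom keep.

Lemma spec_nop S : spec fnop S S 1.
Proof.
split=> T R; exists T, 1; split=> //.
by rewrite -[X in runs _ _ _ X]act_keep; apply: runs_atom.
Qed.

Definition fwhen (b : bool) (F : frag) : frag := if b then F else fnop.

(* Moves one tree off stack 0, reversed, onto the stacks selected by [c1] and
   [c2]; stack 3 counts in unary the subtrees still to be read. *)
Definition fmove_body (c1 c2 : bool) : frag :=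
  fif (ftop i0 ftrue)
    (fseq (fwhen c1 (fpush i1 true)) (fseq (fwhen c2 (fpush i2 true))
      (fseq (fpush i3 true) (fpop i0))))
    (fseq (fwhen c1 (fpush i1 false)) (fseq (fwhen c2 (fpush i2 false))
      (fseq (fpop i3) (fpop i0)))).

Definition fmove (c1 c2 : bool) : frag :=
  fseq (fpush i3 true) (fwhile (ftop i3 fnonempty) (fmove_body c1 c2)).

Definition onto (c : bool) (u v : seq bool) : seq bool :=
  if c then catrev u v else v.

Lemma spec_move_body c1 c2 b s u v n :
  spec (fmove_body c1 c2) [:: b :: s; u; v; nseq n.+1 true]
    [:: s; onto c1 [:: b] u; onto c2 [:: b] v;
        nseq (if b then n.+2 else n) true] 8.
Proof.
apply: (@spec_if _ _ _ _ _ _ 7) => /=.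
have push c i d S : spec (fwhen c (fpush i d)) S
    (if c then set_nth [::] S i (d :: nth [::] S i) else S) 2.
  by case: c; [apply: spec_push | exact: (spec_le (spec_nop S))].
case: b => /=.
  apply: (@spec_seq _ _ _ [:: true :: s; onto c1 [:: true] u; v; nseq n.+1 true] _ 2 5).
    have := push c1 i1 true [:: true :: s; u; v; nseq n.+1 true]; case: (c1) => h; exact: h.
  apply: (@spec_seq _ _ _ [:: true :: s; onto c1 [:: true] u;
    onto c2 [:: true] v; nseq n.+1 true] _ 2 3).
    have := push c2 i2 true
      [:: true :: s; onto c1 [:: true] u; v; nseq n.+1 true]; case: (c2) => h; exact: h.
  apply: (@spec_seq _ _ _ [:: true :: s; onto c1 [:: true] u;
    onto c2 [:: true] v; nseq n.+2 true] _ 2 1);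
    [exact: spec_push | exact: spec_pop].
apply: (@spec_seq _ _ _ [:: false :: s; onto c1 [:: false] u; v; nseq n.+1 true] _ 2 5).
  have := push c1 i1 false [:: false :: s; u; v; nseq n.+1 true]; case: (c1) => h; exact: h.
apply: (@spec_seq _ _ _ [:: false :: s; onto c1 [:: false] u;
  onto c2 [:: false] v; nseq n.+1 true] _ 2 3).
  have := push c2 i2 false
    [:: false :: s; onto c1 [:: false] u; v; nseq n.+1 true]; case: (c2) => h; exact: h.
apply: (@spec_le _ _ _ 2) => //.
apply: (@spec_seq _ _ _ [:: false :: s; onto c1 [:: false] u;
  onto c2 [:: false] v; nseq n true] _ 1 1);
  exact: spec_pop.
Qed.

Lemma onto_cat c u v w : onto c (u ++ v) w = onto c v (onto c u w).
Proof. by case: c => //=; rewrite !catrevE rev_cat catA. Qed.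

Definition sz (t : tree) : nat := size (bits t).

Lemma sz_Cons a b : sz (Cons a b) = (sz a + sz b).+1.
Proof. by rewrite /sz /= size_cat. Qed.

Lemma sz_gt0 t : 0 < sz t.
Proof. by case: t. Qed.

(** The rest of the loop, after [t] has been consumed, is a hypothesis, so the induction can chain
    the two subtrees of a node. The factor 9 is one test plus the 8 steps of the body, for each
    bit. *)
Lemma spec_move_loop c1 c2 t s u v n S t' :
  let W := fwhile (ftop i3 fnonempty) (fmove_body c1 c2) in
  spec W [:: s; onto c1 (bits t) u; onto c2 (bits t) v; nseq n true] S t' ->
  spec W [:: bits t ++ s; u; v; nseq n.+1 true] S (9 * sz t + t').
Proof.
move=> W; elim: t s u v n S t' => [|x IHx y IHy] s u v n S t' H.
  exact: (spec_while_next _ (spec_move_body c1 c2 false s u v n) H).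
rewrite sz_Cons.
have -> : 9 * (sz x + sz y).+1 + t' = (8 + (9 * sz x + (9 * sz y + t'))).+1 by lia.
rewrite /= -catA.
apply: (spec_while_next _ (spec_move_body c1 c2 true _ u v n)) => //.
apply: (IHx _ _ _ n.+1); apply: IHy.
by rewrite -!onto_cat.
Qed.

Lemma spec_move c1 c2 t s u v :
  spec (fmove c1 c2) [:: bits t ++ s; u; v; [::]]
    [:: s; onto c1 (bits t) u; onto c2 (bits t) v; [::]] (2 + (9 * sz t + 1)).
Proof.
apply: (spec_seq (spec_push _ _ _)).
by apply: (@spec_move_loop _ _ _ _ _ _ 0); apply: spec_while_exit.
Qed.

Definition fpour (i : 'I_4) : frag :=
  fwhile (ftop i fnonempty)
    (fif (ftop i ftrue) (fseq (fpush i0 true) (fpop i))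
                        (fseq (fpush i0 false) (fpop i))).

Lemma spec_pour1 s u v :
  spec (fpour i1) [:: s; u; v; [::]] [:: catrev u s; [::]; v; [::]] (5 * size u + 1).
Proof.
elim: u s => [|b u IH] s; first exact: spec_while_exit.
have -> : 5 * size (b :: u) + 1 = (4 + (5 * size u + 1)).+1 by rewrite /=; lia.
apply: spec_while_next (IH (b :: s)) => //; apply: (@spec_if _ _ _ _ _ _ 3).
by case: b; apply: (spec_seq (spec_push _ _ _)); exact: spec_pop.
Qed.

Lemma spec_pour2 s u v :
  spec (fpour i2) [:: s; v; u; [::]] [:: catrev u s; v; [::]; [::]] (5 * size u + 1).
Proof.
elim: u s => [|b u IH] s; first exact: spec_while_exit.
have -> : 5 * size (b :: u) + 1 = (4 + (5 * size u + 1)).+1 by rewrite /=; lia.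
apply: spec_while_next (IH (b :: s)) => //; apply: (@spec_if _ _ _ _ _ _ 3).
by case: b; apply: (spec_seq (spec_push _ _ _)); exact: spec_pop.
Qed.

Notation main s := [:: s; [::]; [::]; [::]].

Definition fdrop := fmove false false.
Definition fdup := fseq (fmove true true) (fseq (fpour i1) (fpour i2)).
(** Moving reverses each tree and pouring restores it; the second tree is poured last and so ends on
    top. *)
Definition fswap :=
  fseq (fmove true false) (fseq (fmove false true) (fseq (fpour i1) (fpour i2))).

Lemma spec_drop t s : spec fdrop (main (bits t ++ s)) (main s) (12 * sz t).
Proof. by apply: spec_le (spec_move _ _ _ _ _ _) _; have := sz_gt0 t; lia. Qed.

Lemma catrev_rev (u s : seq bool) : catrev (catrev u [::]) s = u ++ s.
Proof. by rewrite !catrevE cats0 revK. Qed.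

Lemma size_catrev_nil (u : seq bool) : size (catrev u [::]) = size u.
Proof. by rewrite -/(rev u) size_rev. Qed.

Lemma spec_dup t s :
  spec fdup (main (bits t ++ s)) (main (bits t ++ bits t ++ s)) (24 * sz t).
Proof.
pose u := catrev (bits t) [::].
have := spec_seq (spec_move true true t s [::] [::])
  (spec_seq (spec_pour1 s u u) (spec_pour2 (catrev u s) u [::])).
rewrite /= !catrev_rev size_catrev_nil -/(sz t) => H.
by apply: spec_le H _; have := sz_gt0 t; lia.
Qed.

Lemma spec_swap t t' s :
  spec fswap (main (bits t ++ bits t' ++ s)) (main (bits t' ++ bits t ++ s))
    (24 * (sz t + sz t')).
Proof.
pose u := catrev (bits t) [::]; pose u' := catrev (bits t') [::].
have := spec_seq (spec_move true false t (bits t' ++ s) [::] [::])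
  (spec_seq (spec_move false true t' s u [::])
    (spec_seq (spec_pour1 s u u') (spec_pour2 (catrev u s) u' [::]))).
rewrite /= !catrev_rev !size_catrev_nil -/(sz t) -/(sz t') => H.
by apply: spec_le H _; have := sz_gt0 t; have := sz_gt0 t'; lia.
Qed.

(** * Polynomial-time functions on trees *)

(** The base [(sz x).+1] is at least 2, so constants and sums are absorbed by a larger exponent. *)
Definition pb (P : tree -> Prop) (h : tree -> nat) : Prop :=
  exists D, forall x, P x -> h x <= (sz x).+1 ^ D.

Lemma pb_le P h' h : pb P h' -> (forall x, P x -> h x <= h' x) -> pb P h.
Proof. by move=> [D H] le; exists D => x Px; apply: leq_trans (le x Px) (H x Px). Qed.

Lemma pb_const P c : pb P (fun _ => c).
Proof.
exists c => x _; apply: leq_trans (ltnW (ltn_expl c (leqnn 2))) _.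
by case: c => // c; rewrite leq_exp2r // ltnS sz_gt0.
Qed.

Lemma pb_sz P : pb P sz.
Proof. by exists 1 => x _; rewrite expn1. Qed.

Lemma pb_mul P h h' : pb P h -> pb P h' -> pb P (fun x => h x * h' x).
Proof.
by move=> [D H] [E H']; exists (D + E) => x Px; rewrite expnD leq_mul ?H ?H'.
Qed.

Lemma pb_add P h h' : pb P h -> pb P h' -> pb P (fun x => h x + h' x).
Proof.
move=> [D H] [E H']; exists (D + E).+1 => x Px.
have b := sz_gt0 x; apply: leq_trans (leq_add (H x Px) (H' x Px)) _.
apply: (@leq_trans (2 * (sz x).+1 ^ (D + E))); last by rewrite expnS leq_mul.
by rewrite mul2n -addnn leq_add // leq_exp2l // ?leq_addr ?leq_addl.
Qed.

Lemma pb_exp P h D : pb P h -> pb P (fun x => h x ^ D).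
Proof.
move=> H; elim: D => [|D IH]; first exact: (pb_le (pb_const P 1)).
by apply: pb_le (pb_mul H IH) _ => x _; rewrite expnS.
Qed.

Lemma pb_comp P Q f h :
  pb Q h -> pb P (fun x => sz (f x)) -> (forall x, P x -> Q (f x)) ->
  pb P (fun x => h (f x)).
Proof.
move=> [D H] Hf PQ.
apply: (@pb_le _ (fun x => (sz (f x) + 1) ^ D)).
  exact: pb_exp (pb_add Hf (pb_const _ _)).
by move=> x Px; rewrite addn1; apply: H (PQ x Px).
Qed.

Ltac pb := repeat first [ assumption | exact: pb_sz | match goal with
  | |- pb _ (fun x => addn _ _) => apply: pb_add
  | |- pb _ (fun x => muln _ _) => apply: pb_mul
  | |- pb _ (fun x => expn _ _) => apply: pb_exp
  end | apply: pb_const ].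

(** The rest [s] of the stack is a frame where copies of the argument and earlier results wait. The
    bound on [sz (f x)] serves to bound the time of whatever consumes the result. *)
Definition FPon (P : tree -> Prop) (f : tree -> tree) : Prop :=
  pb P (fun x => sz (f x)) /\
  exists F h, pb P h /\ forall x, P x -> forall s,
    spec F (main (bits x ++ s)) (main (bits (f x) ++ s)) (h x).

Definition FP := FPon (fun _ => True).

Lemma FPon_comp P Q f g :
  FPon P f -> FPon Q g -> (forall x, P x -> Q (f x)) -> FPon P (fun x => g (f x)).
Proof.
move=> [sf [F [hf [bf Hf]]]] [sg [G [hg [bg Hg]]]] PQ; split.
  exact: (pb_comp sg sf PQ).
exists (fseq F G), (fun x => hf x + hg (f x)); split.
  by apply: pb_add => //; apply: pb_comp PQ.
by move=> x Px s; apply: spec_seq (Hf x Px s) (Hg _ (PQ x Px) s).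
Qed.

Lemma FP_comp f g : FP f -> FP g -> FP (fun x => g (f x)).
Proof. by move=> Hf Hg; apply: FPon_comp Hf Hg _. Qed.

Lemma FP_id : FP (fun x => x).
Proof.
split; first exact: pb_sz.
by exists fnop, (fun _ => 1); split=> [|x _ s]; [apply: pb_const | apply: spec_nop].
Qed.

Lemma FP_leaf : FP (fun _ => Leaf).
Proof.
split; first exact: pb_const.
exists (fseq fdrop (fpush i0 false)), (fun x => 12 * sz x + 2).
split=> [|x _ s]; first by pb.
exact: spec_seq (spec_drop _ _) (spec_push _ _ _).
Qed.

Lemma FP_cons f g : FP f -> FP g -> FP (fun x => Cons (f x) (g x)).
Proof.
move=> [sf [F [hf [bf Hf]]]] [sg [G [hg [bg Hg]]]]; split.
  apply: (@pb_le _ (fun x => sz (f x) + sz (g x) + 1)); first by pb.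
  by move=> x _; rewrite sz_Cons addn1.
(* The spare copy of the argument survives below [f x]; the swaps bring it up for [g] and then
   restore the order, and [true] is the prefix code of [Cons]. *)
exists (fseq fdup (fseq F (fseq fswap (fseq G (fseq fswap (fpush i0 true)))))).
exists (fun x => 24 * sz x + (hf x + (24 * (sz (f x) + sz x) +
  (hg x + (24 * (sz (g x) + sz (f x)) + 2))))).
split=> [|x _ s]; first by pb.
apply: (spec_seq (spec_dup _ _)); apply: (spec_seq (Hf _ _ _)) => //.
apply: (spec_seq (spec_swap _ _ _)); apply: (spec_seq (Hg _ _ _)) => //.
apply: (spec_seq (spec_swap _ _ _)).
by rewrite /= -catA; apply: spec_push.
Qed.

Definition hd (t : tree) : tree := if t is Cons a _ then a else Leaf.
Definition tl (t : tree) : tree := if t is Cons _ b then b else Leaf.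
Definition ift (c a b : tree) : tree := if c is Cons _ _ then a else b.

Lemma sz_hd t : sz (hd t) <= sz t.
Proof. by case: t => // a b; rewrite sz_Cons /=; lia. Qed.

Lemma sz_tl t : sz (tl t) <= sz t.
Proof. by case: t => // a b; rewrite sz_Cons /=; lia. Qed.

Lemma FP_hd_id : FP hd.
Proof.
split; first by apply: (pb_le (pb_sz _)) => x _; apply: sz_hd.
exists (fif (ftop i0 ftrue) (fseq (fpop i0) (fseq fswap fdrop)) fnop).
exists (fun x => 36 * sz x + 2); split=> [|[|a b] _ s]; first by pb.
  apply: (@spec_le _ _ _ 2) => //; apply: (@spec_if _ _ _ _ _ _ 1).
  exact: spec_nop.
apply: (@spec_le _ _ _ (1 + (24 * (sz a + sz b) + 12 * sz b)).+1); last first.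
  by rewrite sz_Cons; lia.
apply: spec_if => /=; apply: (spec_seq (spec_pop _ _)); rewrite /= -catA.
exact: spec_seq (spec_swap _ _ _) (spec_drop _ _).
Qed.

Lemma FP_tl_id : FP tl.
Proof.
split; first by apply: (pb_le (pb_sz _)) => x _; apply: sz_tl.
exists (fif (ftop i0 ftrue) (fseq (fpop i0) fdrop) fnop).
exists (fun x => 12 * sz x + 2); split=> [|[|a b] _ s]; first by pb.
  apply: (@spec_le _ _ _ 2) => //; apply: (@spec_if _ _ _ _ _ _ 1).
  exact: spec_nop.
apply: (@spec_le _ _ _ (1 + 12 * sz a).+1); last by rewrite sz_Cons; lia.
apply: spec_if => /=; apply: (spec_seq (spec_pop _ _)); rewrite /= -catA.
exact: spec_drop.
Qed.

Lemma FP_hd f : FP f -> FP (fun x => hd (f x)).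
Proof. by move=> Hf; apply: FP_comp Hf FP_hd_id. Qed.

Lemma FP_tl f : FP f -> FP (fun x => tl (f x)).
Proof. by move=> Hf; apply: FP_comp Hf FP_tl_id. Qed.

Lemma FP_ift c f g : FP c -> FP f -> FP g -> FP (fun x => ift (c x) (f x) (g x)).
Proof.
move=> [sc [C [hc [bc Hc]]]] [sf [F [hf [bf Hf]]]] [sg [G [hg [bg Hg]]]]; split.
  apply: (@pb_le _ (fun x => sz (f x) + sz (g x))); first by pb.
  by move=> x _; case: (c x) => /= *; rewrite ?leq_addr ?leq_addl.
exists (fseq fdup (fseq C (fif (ftop i0 ftrue) (fseq fdrop F) (fseq fdrop G)))).
exists (fun x => 24 * sz x + (hc x + (12 * sz (c x) + (hf x + hg x) + 1))).
split=> [|x _ s]; first by pb.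
apply: (spec_seq (spec_dup _ _)); apply: (spec_seq (Hc _ _ _)) => //.
rewrite addn1; apply: spec_if => /=.
case E: (c x) => [|a b] /=.
  apply: (spec_seq (spec_drop Leaf _)).
  by apply: spec_le (Hg _ _ _) _ => //; rewrite leq_addl.
apply: (spec_seq (spec_drop (Cons a b) _)).
by apply: spec_le (Hf _ _ _) _ => //; rewrite leq_addr.
Qed.

Lemma FP_const t : FP (fun _ => t).
Proof. by elim: t => [|a Ha b Hb]; [apply: FP_leaf | apply: FP_cons]. Qed.

(** [N] bounds the number of rounds and [B] the size of every intermediate value; neither follows
    from [step] being polynomial. *)
Lemma FPon_while (P : tree -> Prop) (c step f : tree -> tree) N B :
  FP c -> FP step -> pb P N -> pb P B ->
  (forall x, P x -> exists n,
    [/\ n <= N x, f x = iter n step x, c (f x) = Leaf,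
        forall i, i < n -> c (iter i step x) <> Leaf &
        forall i, i <= n -> sz (iter i step x) <= B x]) ->
  FPon P f.
Proof.
move=> [[ec sc] [C [hc [[dc bc] Hc]]]] [_ [F [hf [[df bf] Hf]]]] bN bB H; split.
  apply: pb_le bB _ => x Px; have [n [_ -> _ _ -> //]] := H x Px.
pose W := fwhile (ftop i0 ftrue) (fseq fdrop (fseq F (fseq fdup C))).
(* The cost of one round: dropping the tested value, [step], duplicating, and the next test. *)
pose K x := 12 * (B x + 1) ^ ec + ((B x + 1) ^ df + (24 * B x + (B x + 1) ^ dc)).
exists (fseq fdup (fseq C (fseq W (fpop i0)))).
exists (fun x => 24 * B x + ((B x + 1) ^ dc + ((N x * (K x + 1) + 1) + 1))); split.
  by rewrite /K; pb.
move=> x Px s; have [n [nN fE cf cN sB]] := H x Px.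
have s0 := sB 0 (leq0n n).
have m y d : sz y <= B x -> (sz y).+1 ^ d <= (B x + 1) ^ d.
  by rewrite addn1 => le; case: d => // d; rewrite leq_exp2r.
apply: (@spec_seq _ _ _ (main (bits x ++ bits x ++ s))).
  by apply: spec_le (spec_dup _ _) _; rewrite leq_mul2l s0.
apply: (@spec_seq _ _ _ (main (bits (c x) ++ bits x ++ s))).
  by apply: spec_le (Hc _ _ _) _ => //; apply: leq_trans (bc _ _) (m _ _ s0).
apply: (@spec_seq _ _ _ (main (false :: bits (f x) ++ s))); last exact: spec_pop.
(* Induction on the number [j] of remaining rounds. On exit the tested value is [Leaf], a single bit
   [false], which the final pop removes. *)
have loop j : j <= n -> spec W
    (main (bits (c (iter (n - j) step x)) ++ bits (iter (n - j) step x) ++ s))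
    (main (false :: bits (f x) ++ s)) (j * (K x + 1) + 1).
  elim: j => [|j IH] jn.
    by rewrite subn0 -fE cf; apply: spec_while_exit.
  have sj : sz (iter (n - j.+1) step x) <= B x by apply: sB; lia.
  have := cN (n - j.+1); set y := iter (n - j.+1) step x in sj *.
  have yE : iter (n - j) step x = step y by rewrite -iterS; congr iter; lia.
  have sj' : sz (step y) <= B x by rewrite -yE; apply: sB; lia.
  case Ec: (c y) => [|a b] Hy; first by case: Hy => //; lia.
  have -> : j.+1 * (K x + 1) + 1 = (K x + (j * (K x + 1) + 1)).+1 by lia.
  apply: (@spec_while_next _ _ _ _
    (main (bits (c (step y)) ++ bits (step y) ++ s))) => //; last first.
    by rewrite -yE; apply: IH; apply: ltnW.
  rewrite -Ec /K; apply: (@spec_seq _ _ _ (main (bits y ++ s))).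
    apply: spec_le (spec_drop _ _) _; rewrite leq_mul2l.
    by apply: leq_trans (sc _ _) (m _ _ sj).
  apply: (@spec_seq _ _ _ (main (bits (step y) ++ s))).
    by apply: spec_le (Hf _ _ _) _ => //; apply: leq_trans (bf _ _) (m _ _ sj).
  apply: (@spec_seq _ _ _ (main (bits (step y) ++ bits (step y) ++ s))).
    by apply: spec_le (spec_dup _ _) _; rewrite leq_mul2l sj'.
  by apply: spec_le (Hc _ _ _) _ => //; apply: leq_trans (bc _ _) (m _ _ sj').
apply: spec_le (_ : n * (K x + 1) + 1 <= _); last by rewrite leq_add2r leq_mul2r nN orbT.
by have := loop n (leqnn n); rewrite subnn.
Qed.

Definition FP2 (f : tree -> tree -> tree) : Prop := FP (fun z => f (hd z) (tl z)).

Definition FP4 (g : tree -> tree -> tree -> tree -> tree) : Prop :=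
  FP (fun z => g (hd z) (hd (tl z)) (hd (tl (tl z))) (tl (tl (tl z)))).

Lemma FP2_comp f a b : FP2 f -> FP a -> FP b -> FP (fun x => f (a x) (b x)).
Proof. by move=> Hf Ha Hb; apply: (FP_comp (FP_cons Ha Hb) Hf). Qed.

Lemma FP4_comp g a b c d :
  FP4 g -> FP a -> FP b -> FP c -> FP d -> FP (fun x => g (a x) (b x) (c x) (d x)).
Proof.
by move=> Hg Ha Hb Hc Hd;
  apply: (FP_comp (FP_cons Ha (FP_cons Hb (FP_cons Hc Hd))) Hg).
Qed.

Create HintDb fp.

Ltac fp_step := match goal with
  | |- FP (fun x => x) => exact: FP_id
  | |- FP hd => exact: FP_hd_id
  | |- FP tl => exact: FP_tl_id
  | |- FP (fun _ => ?c) => exact: FP_const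
  | |- FP (fun x => Cons _ _) => apply: FP_cons
  | |- FP (fun x => hd _) => apply: FP_hd
  | |- FP (fun x => tl _) => apply: FP_tl
  | |- FP (fun x => ift _ _ _) => apply: FP_ift
  | |- FP (fun x => ?f (@?a x) (@?b x)) =>
      apply: (@FP2_comp f a b); first by eauto with fp
  end.
Ltac fp := rewrite /FP2 /FP4; cbv beta; repeat fp_step.

(** * Structural recursion with an explicit stack *)

Section StructuralRecursion.

Variables (g : tree -> tree -> tree -> tree -> tree) (pl pr : tree -> tree -> tree).

(** A parameter travels downwards, changed by [pl] and [pr], and results travel upwards through [g].
    Equality, membership, mapping, guard evaluation and effect collection are all instances. *)
Fixpoint trec (p t : tree) : tree :=
  match t with
  | Leaf => g p Leaf Leaf Leaf
  | Cons x y => g p t (trec (pl p t) x) (trec (pr p t) y)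
  end.

Let eval (p t : tree) : tree := Cons Leaf (Cons p t).
Let reduce (p t : tree) : tree := Cons (Cons Leaf Leaf) (Cons p t).

(* The recursion is run on an explicit stack of pending calls and a stack of
   computed values: the state is [Cons calls values]. *)
Let step (y : tree) : tree :=
  let rest := tl (hd y) in let v := tl y in
  let p := hd (tl (hd (hd y))) in let t := tl (tl (hd (hd y))) in
  ift (hd (hd (hd y)))
    (Cons rest (Cons (g p t (hd (tl v)) (hd v)) (tl (tl v))))
    (ift t
      (Cons (Cons (eval (pl p t) (hd t)) (Cons (eval (pr p t) (tl t))
               (Cons (reduce p t) rest))) v)
      (Cons rest (Cons (g p Leaf Leaf Leaf) v))).

Let walk (B : nat) (y : tree) (n : nat) (z : tree) : Prop :=
  z = iter n step y /\
  forall i, i < n -> hd (iter i step y) <> Leaf /\ sz (iter i step y) <= B.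

Let walk_step B y z :
  z = step y -> hd y <> Leaf -> sz y <= B -> walk B y 1 z.
Proof. by move=> -> h1 h2; split=> // -[|]. Qed.

Let walk_trans B y n z m w : walk B y n z -> walk B z m w -> walk B y (n + m) w.
Proof.
move=> [-> H1] [-> H2]; split; first by rewrite addnC iterD.
move=> i lt; case: (ltnP i n) => [/H1 //|le].
have -> : i = (i - n) + n by lia.
by rewrite iterD; apply: H2; lia.
Qed.

Let steps : tree -> nat :=
  fix steps t := if t is Cons x y then 1 + (steps x + (steps y + 1)) else 1.

Lemma steps_le t : steps t <= 2 * sz t.
Proof. by elim: t => // x IHx y IHy; rewrite sz_Cons /=; lia. Qed.

Variable c : nat.
Hypothesis sz_pl : forall p t, sz (pl p t) <= sz p + c.
Hypothesis sz_pr : forall p t, sz (pr p t) <= sz p + c.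

(** Descending one level adds at most [c] to the parameter and shortens the tree, so
    [sz p + c * sz t] never grows. [L] is the stack space charged to each node: three pending calls
    of size at most [6 + Pm + Nm] and two computed values. *)
Let walk_eval Pm Nm Rm B t :
  let L := 3 * (6 + Pm + Nm) + 2 * Rm + 2 in
  (forall p t, sz p <= Pm -> sz t <= Nm -> sz (trec p t) <= Rm) ->
  forall p k v, sz p + c * sz t <= Pm -> sz t <= Nm ->
  sz k + sz v + L * sz t <= B ->
  walk B (Cons (Cons (eval p t) k) v) (steps t) (Cons k (Cons (trec p t) v)).
Proof.
move=> L HR; have: L = 3 * (6 + Pm + Nm) + 2 * Rm + 2 by [].
move: L => L LE; elim: t => [|x IHx y IHy] p k v HP HN HB.
  apply: walk_step => //.
  by move: HP HN HB; rewrite /eval !sz_Cons -[sz Leaf]/1; lia.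
have lx := sz_pl p (Cons x y); have ly := sz_pr p (Cons x y).
move: HP HN HB; rewrite sz_Cons !mulnS !mulnDr => HP HN HB.
have HPx : sz (pl p (Cons x y)) + c * sz x <= Pm by lia.
have HPy : sz (pr p (Cons x y)) + c * sz y <= Pm by lia.
have Rx : sz (trec (pl p (Cons x y)) x) <= Rm by apply: HR; lia.
have Ry : sz (trec (pr p (Cons x y)) y) <= Rm by apply: HR; lia.
apply: walk_trans (walk_step _ _ _) _; first exact: erefl.
- by [].
- by rewrite /eval !sz_Cons -?[sz Leaf]/1; lia.
apply: walk_trans.
  by apply: IHx; rewrite /eval /reduce ?sz_Cons /= -?[sz Leaf]/1; lia.
apply: walk_trans.
  by apply: IHy; rewrite /eval /reduce ?sz_Cons /= -?[sz Leaf]/1; lia.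
apply: walk_step => //.
by rewrite /eval /reduce !sz_Cons /= -?[sz Leaf]/1; lia.
Qed.

Hypotheses (FPg : FP4 g) (FPpl : FP2 pl) (FPpr : FP2 pr).
Hypothesis sz_trec : pb (fun _ => True) (fun z => sz (trec (hd z) (tl z))).

(** The size bound [sz_trec] on results is an assumption because a [g] that duplicates its results
    would make them exponential. The loop starts from one pending call and ends with one value. *)
Lemma FP2_trec : FP2 trec.
Proof.
pose init z := Cons (Cons (eval (hd z) (tl z)) Leaf) Leaf.
pose P y := exists p t, y = Cons (Cons (eval p t) Leaf) Leaf.
pose arg y := tl (hd (hd y)).
pose f y := Cons Leaf (Cons (trec (hd (arg y)) (tl (arg y))) Leaf).
have Finit : FP init by rewrite /init /eval; fp.
suff Ff : FPon P f.
  apply: (FPon_comp (FPon_comp Finit Ff (Q := P) _) (FP_hd FP_tl_id) (Q := fun _ => True)) => //.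
  by move=> x _; exists (hd x), (tl x).
have [D HD] := sz_trec.
(* The parameter gains at most [c] on each of at most [sz y] levels; [Rm] is the assumed result
   bound at such arguments, and [B] adds room for the final state to the space needed by
   [walk_eval]. *)
pose Pm y := (c + 1) * sz y.
pose Rm y := (Pm y + sz y + 2) ^ D.
pose B y := 2 + (3 * (6 + Pm y + sz y) + 2 * Rm y + 2) * sz y + (Rm y + 4).
apply: (@FPon_while P hd step f (fun y => 2 * sz y) B).
- exact: FP_hd_id.
- by rewrite /step /eval /reduce; fp; apply: FP4_comp => //; fp.
- by pb.
- by rewrite /B /Rm /Pm; pb.
move=> _ [p [t ->]]; set y := Cons _ _; exists (steps t).
have yE : sz y = 7 + sz p + sz t by rewrite /y /eval !sz_Cons -?[sz Leaf]/1; lia.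
have HR q s : sz q <= Pm y -> sz s <= sz y -> sz (trec q s) <= Rm y.
  move=> Hq Hs; apply: leq_trans (HD (Cons q s) I) _.
  by rewrite /Rm sz_Cons; case: (D) => // d; rewrite leq_exp2r //; lia.
have Hp : sz p + c * sz t <= Pm y by rewrite /Pm yE; nia.
have [e W] := walk_eval HR (k := Leaf) (v := Leaf) (B := B y) Hp
  ltac:(rewrite yE; lia) ltac:(rewrite /B -?[sz Leaf]/1 yE; nia).
split=> //.
- by apply: leq_trans (steps_le t) _; rewrite leq_mul2l yE; lia.
- by move=> i /W[].
move=> i; rewrite leq_eqVlt => /orP[/eqP->|/W[] //].
rewrite -e !sz_Cons -?[sz Leaf]/1.
have : sz (trec p t) <= Rm y by apply: HR; rewrite /Pm yE; nia.
by rewrite /B; lia.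
Qed.

End StructuralRecursion.

Notation yesT := (Cons Leaf Leaf).

Definition truth (t : tree) : bool := if t is Cons _ _ then true else false.

Lemma iftE c a b : ift c a b = if truth c then a else b.
Proof. by case: c. Qed.

Lemma truth_ift c a b : truth (ift c a b) = if truth c then truth a else truth b.
Proof. by case: c. Qed.

Fixpoint inT (o l : tree) : Prop :=
  if l is Cons a l' then o = a \/ inT o l' else False.

Lemma leq_pow_mono a b d : a <= b -> a ^ d <= b ^ d.
Proof. by case: d => // d; rewrite leq_exp2r. Qed.

Lemma FP2_sz f : FP2 f ->
  exists D, forall p t, sz (f p t) <= (sz p + sz t + 2) ^ D.
Proof.
move=> [[D H] _]; exists D => p t; have := H (Cons p t) I.
by rewrite /= sz_Cons addn2.
Qed.

Lemma sz_pair_pb (h : nat -> nat -> nat) (f : tree -> tree -> tree) :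
  (forall p t, sz (f p t) <= h (sz p) (sz t)) ->
  (forall a b a' b', a <= a' -> b <= b' -> h a b <= h a' b') ->
  pb (fun _ => True) (fun z => h (sz z) (sz z)) ->
  pb (fun _ => True) (fun z => sz (f (hd z) (tl z))).
Proof.
move=> H mono Hpb; apply: pb_le Hpb _ => z _; apply: leq_trans (H _ _) _.
by apply: mono; [apply: sz_hd | apply: sz_tl].
Qed.

(** * Boolean recursion *)

Section BooleanRecursion.

Variables (g : tree -> tree -> tree -> tree -> tree) (pl pr : tree -> tree -> tree).
Variable c : nat.

(** Results are normalised to [yesT] or [Leaf], so they have size at most 3 and the size hypothesis
    of the recursion comes for free. *)
Definition brec := trec (fun p t l r => ift (g p t l r) yesT Leaf) pl pr.

Lemma FP2_brec :
  (forall p t, sz (pl p t) <= sz p + c) -> (forall p t, sz (pr p t) <= sz p + c) ->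
  FP4 g -> FP2 pl -> FP2 pr -> FP2 brec.
Proof.
move=> h1 h2 Hg Hpl Hpr; apply: (FP2_trec h1 h2) => //.
  rewrite /FP4; apply: FP_ift; [exact: Hg | exact: FP_const..].
apply: (@pb_le _ (fun _ => 3)); first exact: pb_const.
by move=> z _; case: (tl z) => [|x y] /=; case: (g _ _ _ _).
Qed.

End BooleanRecursion.

(** Recursion on the second tree, while the first, as the parameter, is taken apart in parallel. *)
Definition eqT : tree -> tree -> tree :=
  brec (fun p t l r => ift t (ift p (ift l r Leaf) Leaf) (ift p Leaf yesT))
    (fun p _ => hd p) (fun p _ => tl p).

Lemma FP2_eqT : FP2 eqT.
Proof.
apply: (@FP2_brec _ _ _ 0); try by fp.
- by move=> p t; rewrite addn0 sz_hd.
- by move=> p t; rewrite addn0 sz_tl.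
Qed.
#[local] Hint Resolve FP2_eqT : fp.

Lemma eqTP p t : reflect (p = t) (truth (eqT p t)).
Proof.
elim: t p => [|x IHx y IHy] [|a b]; try by constructor.
have -> : eqT (Cons a b) (Cons x y) =
  ift (ift (eqT a x) (eqT b y) Leaf) yesT Leaf by [].
rewrite !truth_ift; case: IHx => [->|ne] /=; last by constructor=> -[].
by case: IHy => [->|ne]; constructor=> // -[].
Qed.

Definition memT : tree -> tree -> tree :=
  brec (fun p t l r => ift t (ift (eqT p (hd t)) yesT r) Leaf)
    (fun _ _ => Leaf) (fun p _ => p).

Lemma FP2_memT : FP2 memT.
Proof.
apply: (@FP2_brec _ _ _ 0); try by fp.
- by move=> p t; rewrite addn0 sz_gt0.
- by move=> p t; rewrite addn0.
Qed.
#[local] Hint Resolve FP2_memT : fp.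

Lemma memTP o l : reflect (inT o l) (truth (memT o l)).
Proof.
elim: l => [|a _ l IH]; first by constructor.
have -> : memT o (Cons a l) = ift (ift (eqT o a) yesT (memT o l)) yesT Leaf by [].
rewrite !truth_ift; case: eqTP => [->|ne] /=; first by constructor; left.
by case: IH => H; constructor; [right | case].
Qed.

(** * Lists of trees *)

Definition appT (a b : tree) : tree :=
  trec (fun p t _ r => ift t (Cons (hd t) r) p) (fun _ _ => Leaf) (fun p _ => p) b a.

Lemma appT_Cons x a b : appT (Cons x a) b = Cons x (appT a b).
Proof. by []. Qed.

Lemma sz_appT a b : sz (appT a b) <= sz a + sz b.
Proof.
elim: a => [|x _ a IH]; first by rewrite /appT /= leq_addl.
by rewrite appT_Cons !sz_Cons; lia.
Qed.

Lemma FP2_appT : FP2 appT.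
Proof.
suff H : FP2 (fun b a => appT a b).
  by rewrite /FP2; apply: (@FP2_comp (fun b a => appT a b)) => //; fp.
apply: (@FP2_trec _ _ _ 0); try by fp.
- by move=> p t; rewrite addn0 sz_gt0.
- by move=> p t; rewrite addn0.
apply: (@sz_pair_pb (fun a b => a + b) (fun b a => appT a b)).
- by move=> p t; rewrite addnC sz_appT.
- by move=> *; apply: leq_add.
by pb.
Qed.
#[local] Hint Resolve FP2_appT : fp.

Lemma inT_appT o a b : inT o (appT a b) <-> inT o a \/ inT o b.
Proof.
elim: a => [|x _ a IH]; first by split=> [|[]] //; right.
by rewrite appT_Cons /= IH; tauto.
Qed.

Section Map.

Variable f : tree -> tree -> tree.

Definition mapT : tree -> tree -> tree :=
  trec (fun p t _ r => ift t (Cons (f p (hd t)) r) Leaf)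
    (fun _ _ => Leaf) (fun p _ => p).

Lemma mapT_Cons e a l : mapT e (Cons a l) = Cons (f e a) (mapT e l).
Proof. by []. Qed.

Lemma FP2_mapT : FP2 f -> FP2 mapT.
Proof.
move=> Hf; apply: (@FP2_trec _ _ _ 0); try by fp.
- by move=> p t; rewrite addn0 sz_gt0.
- by move=> p t; rewrite addn0.
have [D HD] := FP2_sz Hf.
apply: (@sz_pair_pb (fun a b => b * ((a + b + 2) ^ D + 1)) mapT); last by pb.
(* The bound [b] stays fixed during the induction, so the base of the power does not change with the
   tail. *)
- move=> p t; suff: forall b, sz t <= b -> sz (mapT p t) <= sz t * ((sz p + b + 2) ^ D + 1).
    exact.
  elim: t => [|x _ t IH] b.
    by rewrite -[sz (mapT _ _)]/1 -?[sz Leaf]/1; nia.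
  rewrite mapT_Cons !sz_Cons => le.
  have := IH b ltac:(lia); have := HD p x.
  have : (sz p + sz x + 2) ^ D <= (sz p + b + 2) ^ D by apply: leq_pow_mono; lia.
  have := sz_gt0 x; have := sz_gt0 t.
  by move: (_ ^ D) (_ ^ D) => u v; nia.
move=> a b a' b' la lb; apply: leq_mul => //; rewrite leq_add2r.
by apply: leq_pow_mono; lia.
Qed.

Lemma inT_mapT o e l : inT o (mapT e l) <-> exists2 a, inT a l & o = f e a.
Proof.
elim: l => [|x _ l IH]; first by split=> // -[].
rewrite mapT_Cons /= IH; split.
  by case=> [->|[a al ->]]; [exists x => //; left | exists a => //; right].
by case=> a [->|al] ->; [left | right; exists a].
Qed.

End Map.

Section Gather.

Variables (own pl pr : tree -> tree -> tree) (c : nat).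

(* Collects [own] over the visited subtrees; a subtree is visited with the
   parameter that its parent computes for it, and [Leaf] prunes. *)
Definition gather : tree -> tree -> tree :=
  trec (fun p t l r => ift p (appT (own p t) (appT l r)) Leaf) pl pr.

Lemma gather_Leaf t : gather Leaf t = Leaf.
Proof. by case: t. Qed.

Lemma inT_gather_Leaf o a b : inT o (gather (Cons a b) Leaf) <-> inT o (own (Cons a b) Leaf).
Proof. by rewrite /gather /= inT_appT; split=> [[]|] //; left. Qed.

Lemma inT_gather o a b x y : let p := Cons a b in let t := Cons x y in
  inT o (gather p t) <->
  inT o (own p t) \/ inT o (gather (pl p t) x) \/ inT o (gather (pr p t) y).
Proof.
move=> p t; have -> : gather p t =
  appT (own p t) (appT (gather (pl p t) x) (gather (pr p t) y)) by [].
by rewrite !inT_appT.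
Qed.

Hypotheses (sz_pl : forall p t, sz (pl p t) <= sz p + c)
  (sz_pr : forall p t, sz (pr p t) <= sz p + c).

(** Results are only concatenated: each of the at most [sz t] visited subtrees contributes one [own]
    list of polynomial size. *)
Lemma FP2_gather : FP2 own -> FP2 pl -> FP2 pr -> FP2 gather.
Proof.
move=> Ho Hpl Hpr; apply: (FP2_trec sz_pl sz_pr) => //; first by fp.
have [D HD] := FP2_sz Ho.
apply: (@sz_pair_pb (fun a b => b * ((a + c * b + b + 2) ^ D + 2)) gather); last by pb.
- move=> p t.
  suff: forall P N, sz p + c * sz t <= P -> sz t <= N ->
      sz (gather p t) <= sz t * ((P + N + 2) ^ D + 2) by exact.
  move=> P N; have : (P + N + 2) ^ D = (P + N + 2) ^ D by [].
  move: {2 3}(_ ^ D) => O OE.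
  have HO q s : sz q <= P -> sz s <= N -> sz (own q s) <= O.
    move=> hq hs; apply: leq_trans (HD q s) _; rewrite -OE.
    by apply: leq_pow_mono; lia.
  elim: t p => [|x IHx y IHy] p.
    rewrite -[sz Leaf]/1 => hp hN.
    have -> : gather p Leaf = ift p (appT (own p Leaf) Leaf) Leaf by [].
    rewrite iftE; case: ifP => _; last by rewrite -[sz Leaf]/1; lia.
    apply: leq_trans (sz_appT _ _) _.
    by have := HO p Leaf; rewrite -[sz Leaf]/1; lia.
  rewrite sz_Cons mulnS mulnDr => hp hN.
  have -> : gather p (Cons x y) = ift p (appT (own p (Cons x y))
    (appT (gather (pl p (Cons x y)) x) (gather (pr p (Cons x y)) y))) Leaf by [].
  rewrite iftE; have := sz_pl p (Cons x y); have := sz_pr p (Cons x y) => lr ll.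
  case: ifP => _; last by rewrite -[sz Leaf]/1; lia.
  apply: leq_trans (sz_appT _ _) _.
  have := sz_appT (gather (pl p (Cons x y)) x) (gather (pr p (Cons x y)) y).
  have := IHx (pl p (Cons x y)) ltac:(lia) ltac:(lia).
  have := IHy (pr p (Cons x y)) ltac:(lia) ltac:(lia).
  have := HO p (Cons x y) ltac:(lia) ltac:(rewrite sz_Cons; lia).
  by rewrite mulSn !mulnDl; lia.
move=> a b a' b' la lb; apply: leq_mul => //; rewrite leq_add2r.
apply: leq_pow_mono; have : c * b <= c * b' by rewrite leq_mul2l lb orbT.
by lia.
Qed.

End Gather.

Section ConcatMap.

Variable f : tree -> tree -> tree.

(* The function receives the index of the list item, in unary, on top of the
   environment. *)
Definition cmapi (e l : tree) : tree :=
  gather (fun p t => ift t (f p (hd t)) Leaf) (fun _ _ => Leaf)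
    (fun p _ => Cons (Cons Leaf (hd p)) (tl p)) (Cons Leaf e) l.

Lemma FP2_cmapi : FP2 f -> FP2 cmapi.
Proof.
move=> Hf; rewrite /FP2 /cmapi; set G := gather _ _ _.
have HG : FP2 G.
  apply: (@FP2_gather _ _ _ 5); try by fp.
  - by move=> p t; rewrite -[sz Leaf]/1; have := sz_gt0 p; lia.
  move=> [|a b] t; first by [].
  by rewrite !sz_Cons /= -[sz Leaf]/1; lia.
by fp.
Qed.

Lemma inT_cmapi o e ts :
  inT o (cmapi e (tlist ts)) <->
  exists i a, onth ts i = Some a /\ inT o (f (Cons (tnat i) e) a).
Proof.
rewrite /cmapi; set G := gather _ _ _.
suff H j : inT o (G (Cons (tnat j) e) (tlist ts)) <->
    exists i a, onth ts i = Some a /\ inT o (f (Cons (tnat (j + i)) e) a).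
  exact: (H 0).
elim: ts j => [|t ts IH] j.
  by rewrite inT_gather_Leaf; split=> //= -[[|i] [a []]].
rewrite inT_gather gather_Leaf /=; split.
  case=> [H|[//|/(IH j.+1)[i [a [H1 H2]]]]].
    by exists 0, t; rewrite addn0.
  by exists i.+1, a; rewrite addnS.
case=> -[|i] [a [/= H1 H2]].
  by left; case: H1 H2 => ->; rewrite addn0.
right; right; apply/(IH j.+1); exists i, a; split=> //.
by rewrite addSnnS.
Qed.

End ConcatMap.

Definition cmapT (f : tree -> tree -> tree) : tree -> tree -> tree :=
  cmapi (fun p a => f (tl p) a).

Lemma FP2_cmapT f : FP2 f -> FP2 (cmapT f).
Proof. by move=> Hf; apply: FP2_cmapi; fp. Qed.

Lemma inT_tlist o ts : inT o (tlist ts) <-> exists i, onth ts i = Some o.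
Proof.
elim: ts => [|t ts IH] /=; first by split=> // -[[]].
rewrite IH; split; first by case=> [->|[i H]]; [exists 0 | exists i.+1].
by case=> -[[->]|i H]; [left | right; exists i].
Qed.

Lemma tlistP l : exists ts, l = tlist ts.
Proof. by elim: l => [|a _ l [ts ->]]; [exists [::] | exists (a :: ts)]. Qed.

Lemma inT_cmapT f o e l :
  inT o (cmapT f e l) <-> exists2 a, inT a l & inT o (f e a).
Proof.
have [ts ->] := tlistP l; rewrite inT_cmapi; split.
  by case=> i [a [H1 H2]]; exists a => //; apply/inT_tlist; exists i.
by case=> a /inT_tlist[i H1] H2; exists i, a.
Qed.

#[local] Hint Resolve FP2_mapT FP2_cmapT FP2_cmapi : fp.

(** * The saturation algorithm on encoded networks *)

(** Case distinction on a unary number; the last branch serves every number from 5 on. *)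
Definition sw (n a b c d e f : tree) : tree :=
  ift n (ift (tl n) (ift (tl (tl n)) (ift (tl (tl (tl n)))
    (ift (tl (tl (tl (tl n)))) f e) d) c) b) a.

Definition nd (i : nat) (t : tree) : tree := hd (iter i tl t).

(* An environment lists the known items, the index of the current middlebox,
   the ingress port and the packet. *)
Definition envT (K m v p : tree) : tree := Cons K (Cons m (Cons v p)).
Definition eK (E : tree) := hd E.
Definition em (E : tree) := hd (tl E).
Definition ev (E : tree) := hd (tl (tl E)).
Definition ep (E : tree) := tl (tl (tl E)).

Definition termT (E t : tree) : tree :=
  sw (hd t) (nd 0 (ep E)) (nd 1 (ep E)) (nd 2 (ep E)) (ev E) (nd 2 t) (nd 2 t).

(** Items are told apart by shape: [Leaf] is abort, a leading [Leaf] marks a fact, and a channel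
    item starts with its edge, which is a [Cons]. *)
Definition factT (E r a : tree) : tree :=
  Cons Leaf (Cons (em E) (Cons r (mapT termT E a))).

(* The mode of a subtree: 0 for a guard, and 1, 2, 3 for an argument list to be
   negated, conjoined or disjoined. *)
Definition guard_node (p t l r : tree) : tree :=
  ift t
    (sw (hd p)
      (sw (hd t)
        (eqT (termT (tl p) (nd 1 t)) (termT (tl p) (nd 2 t)))
        (memT (factT (tl p) (nd 1 t) (nd 2 t)) (eK (tl p)))
        r r r r)
      (ift l Leaf yesT) (ift l r Leaf) (ift l yesT r) Leaf Leaf)
    (sw (hd p) Leaf Leaf yesT Leaf Leaf Leaf).

Definition guard_left (p t : tree) : tree := Cons Leaf (tl p).

Definition guard_right (p t : tree) : tree :=
  sw (hd p)
    (Cons (sw (hd t) Leaf Leaf (tnat 1) (tnat 2) (tnat 3) Leaf) (tl p))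
    p p p p p.

Definition guardT : tree -> tree -> tree := brec guard_node guard_left guard_right.

Definition outT (E o : tree) : tree :=
  Cons (Cons (Cons (tnat 1) (em E)) (termT E (nd 3 o)))
    (Cons (termT E (nd 0 o)) (Cons (termT E (nd 1 o))
      (Cons (termT E (nd 2 o)) Leaf))).

(* The mode of a subtree: 0 for a command, 1 for the list of the two parts of a
   sequence, 2 for the argument list of a block, 3 for its list of branches and
   4 for a branch. *)
Definition eff_own (p t : tree) : tree :=
  ift (hd p) Leaf (ift t
    (sw (hd t)
      (mapT outT (tl p) (nd 1 t))
      (Cons Leaf Leaf)
      (Cons (factT (tl p) (nd 1 t) (nd 2 t)) Leaf)
      Leaf Leaf Leaf) Leaf).

Definition eff_left (p t : tree) : tree :=
  sw (hd p) Leaf (Cons Leaf (tl p)) (Cons (tnat 3) (tl p)) (Cons (tnat 4) (tl p))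
    Leaf Leaf.

(** Guards are evaluated on the way down: a false guard hands [Leaf] to its command and thereby
    prunes it. *)
Definition eff_right (p t : tree) : tree :=
  sw (hd p)
    (sw (hd t) Leaf Leaf Leaf Leaf (Cons (tnat 1) (tl p)) (Cons (tnat 2) (tl p)))
    p Leaf p
    (ift (guardT (Cons Leaf (tl p)) (hd t)) (Cons Leaf (tl p)) Leaf) Leaf.

Definition effT : tree -> tree -> tree := gather eff_own eff_left eff_right.

(** The sending host is known only as a position in the list [sends]; [Cons Leaf _] is the code of a
    host node. *)
Definition sendT (edges sends : tree) : tree :=
  cmapi (fun he ps => cmapT (fun he p => cmapT
    (fun hp e => ift (eqT (hd e) (Cons Leaf (hd hp)))
      (Cons (Cons e (tl hp)) Leaf) Leaf) (Cons (hd he) p) (tl he)) he ps)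
    edges sends.

(** A nonempty [hd] singles out channel items, and the sender on the channel is also the code of the
    ingress port. *)
Definition recvT (e it : tree) : tree :=
  ift (hd it)
    (ift (eqT (tl (hd it)) (Cons (tnat 1) (hd (hd e))))
      (effT (Cons Leaf (envT (tl (hd e)) (hd (hd e)) (hd (hd it)) (tl it))) (tl e))
      Leaf)
    Leaf.

Definition mboxT (mK mb : tree) : tree :=
  appT (mapT (fun m f => Cons Leaf (Cons m f)) (hd mK) (nd 2 mb))
    (cmapT recvT (Cons mK (nd 1 mb)) (tl mK)).

Definition candT (K net : tree) : tree :=
  appT (sendT (nd 3 net) (nd 4 net)) (cmapi mboxT K (nd 5 net)).

Definition freshT (K net : tree) : tree :=
  cmapT (fun K it => ift (memT it K) Leaf (Cons it Leaf)) K (candT K net).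

(** With no fresh item this would add [Leaf], the code of abort; the loop stops before that
    happens. *)
Definition roundT (y : tree) : tree :=
  Cons (Cons (hd (freshT (hd y) (tl y))) (hd y)) (tl y).

Lemma FP_sw n a b c d e f : FP n -> FP a -> FP b -> FP c -> FP d -> FP e -> FP f ->
  FP (fun x => sw (n x) (a x) (b x) (c x) (d x) (e x) (f x)).
Proof. by move=> Hn *; rewrite /sw; repeat apply: FP_ift => //; repeat apply: FP_tl. Qed.

Lemma FP_nd i f : FP f -> FP (fun x => nd i (f x)).
Proof.
move=> Hf; rewrite /nd; apply: FP_hd; elim: i => [|i IH] //.
exact: FP_tl IH.
Qed.

Ltac fps := rewrite /FP2 /FP4 /guard_node /guard_left /guard_right
  /eff_own /eff_left /eff_right /outT /factT /envT /eK /em /ev /ep; cbv beta;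
  repeat first [ match goal with
  | |- FP (fun x => sw _ _ _ _ _ _ _) => apply: FP_sw
  | |- FP (fun x => nd _ _) => apply: FP_nd
  end | fp_step | assumption ].

Lemma FP2_termT : FP2 termT.
Proof. by rewrite /termT; fps. Qed.
#[local] Hint Resolve FP2_termT : fp.

Lemma sz_ift M c a b : sz a <= M -> sz b <= M -> sz (ift c a b) <= M.
Proof. by rewrite iftE; case: ifP. Qed.

Lemma sz_sw M n a b c d e f :
  sz a <= M -> sz b <= M -> sz c <= M -> sz d <= M -> sz e <= M -> sz f <= M ->
  sz (sw n a b c d e f) <= M.
Proof. by move=> *; do 5!apply: sz_ift => //. Qed.

Lemma FP2_guardT : FP2 guardT.
Proof.
apply: (@FP2_brec _ _ _ 10); [| | by fps..] => p t.
  by rewrite /guard_left sz_Cons -[sz Leaf]/1; have := sz_tl p; lia.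
apply: sz_sw; rewrite ?leq_addr // sz_Cons.
suff: sz (sw (hd t) Leaf Leaf (tnat 1) (tnat 2) (tnat 3) Leaf) <= 7.
  by have := sz_tl p; lia.
exact: sz_sw.
Qed.
#[local] Hint Resolve FP2_guardT : fp.

Lemma FP2_outT : FP2 outT.
Proof. by fps. Qed.
#[local] Hint Resolve FP2_outT : fp.

Lemma FP2_effT : FP2 effT.
Proof.
(* The largest mode, [tnat 4], has size 9, and the [Cons] above it adds one. *)
apply: (@FP2_gather _ _ _ 10); [| | by fps..] => p t.
  by apply: sz_sw; rewrite /tnat /= ?sz_Cons; move: (sz_tl p) (sz_gt0 p);
    rewrite -?[sz Leaf]/1; lia.
by do ![apply: sz_sw | apply: sz_ift]; rewrite /tnat /= ?sz_Cons;
  move: (sz_tl p) (sz_gt0 p); rewrite -?[sz Leaf]/1; lia.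
Qed.
#[local] Hint Resolve FP2_effT : fp.

Lemma FP2_sendT : FP2 sendT.
Proof.
apply: FP2_cmapi; rewrite /FP2; apply: FP2_comp; [|by fps..].
apply: FP2_cmapT; rewrite /FP2; apply: FP2_comp; [|by fps..].
by apply: FP2_cmapT; fps.
Qed.
#[local] Hint Resolve FP2_sendT : fp.

Lemma FP2_recvT : FP2 recvT.
Proof. by rewrite /recvT; fps. Qed.
#[local] Hint Resolve FP2_recvT : fp.

Lemma FP2_mboxT : FP2 mboxT.
Proof.
rewrite /mboxT; fps; apply: FP2_comp; [|by fps..].
by apply: FP2_mapT; fps.
Qed.
#[local] Hint Resolve FP2_mboxT : fp.

Lemma FP2_candT : FP2 candT.
Proof. by rewrite /candT; fps. Qed.
#[local] Hint Resolve FP2_candT : fp.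

Lemma FP2_freshT : FP2 freshT.
Proof.
rewrite /freshT /FP2; apply: FP2_comp; [|by fps..].
by apply: FP2_cmapT; fps.
Qed.
#[local] Hint Resolve FP2_freshT : fp.

Lemma FP_roundT : FP roundT.
Proof. by rewrite /roundT; fps. Qed.

(** * Execution of increasing programs *)

Section Programs.

Variables (nH nT : nat) (Pt : finType) (nR : nat) (sig : 'I_nR -> seq sort).
Notation command := (command nH nT Pt sig).
Notation guard := (guard nH nT Pt sig).
Notation valuation := (valuation nH nT Pt sig).
Notation fact := (fact nH nT Pt sig).
Notation input := (packet nH nT * Pt)%type.
Notation pstate := (valuation * {set packet nH nT * Pt})%type.

(** Commands are nested inside the list of a [Block]; this principle supplies induction hypotheses
    for the branches. *)
Lemma command_nested_ind (P : command -> Prop) :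
  (forall os, P (Output sig os)) -> P (Abort nH nT Pt sig) ->
  (forall r (a : args nH nT Pt (sig r)), P (Insert a)) ->
  (forall r (a : args nH nT Pt (sig r)), P (Remove a)) ->
  (forall c1 c2, P c1 -> P c2 -> P (Seq c1 c2)) ->
  (forall gcs, foldr (fun gc R => P gc.2 /\ R) True gcs -> P (Block gcs)) ->
  forall c, P c.
Proof.
move=> HO HA HI HR HS HB; fix F 1; case.
- exact: HO.
- exact: HA.
- exact: HI.
- exact: HR.
- by move=> c1 c2; apply: HS.
by move=> gcs; apply: HB; elim: gcs => //= -[g c] gcs IH; split.
Qed.

(** Both polarities are treated at once, since a negation exchanges them. *)
Lemma holds_mono (x : input) (q1 q2 : valuation) (b : bool) (g : guard) :
  mem_polarity b g -> q1 \subset q2 ->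
  if b then holds x q1 g -> holds x q2 g else holds x q2 g -> holds x q1 g.
Proof.
elim: g b => [s t1 t2|r a|g IH|g1 IH1 g2 IH2|g1 IH1 g2 IH2] b /=.
- by case: b.
- by case: b => // _ /subsetP; apply.
- by move=> H S; have := IH _ H S; case: b {H} => /= H; apply: contra.
- case/andP=> H1 H2 S; have := IH1 _ H1 S; have := IH2 _ H2 S.
  by case: b {H1 H2} => F1 F2 /andP[/F2-> /F1->].
case/andP=> H1 H2 S; have := IH1 _ H1 S; have := IH2 _ H2 S.
by case: b {H1 H2} => F1 F2 /orP[/F2->|/F1->] //; rewrite orbT.
Qed.

Lemma holds_sub (x : input) (q1 q2 : valuation) (g : guard) :
  no_negated_mem g -> q1 \subset q2 -> holds x q1 g -> holds x q2 g.
Proof. exact: (@holds_mono x q1 q2 true g). Qed.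

Lemma increasing_branch (gcs : seq (guard * command)) i g c :
  foldr (fun gc P => [/\ no_negated_mem gc.1, increasing_command gc.2 & P]) True gcs ->
  onth gcs i = Some (g, c) -> no_negated_mem g /\ increasing_command c.
Proof.
elim: gcs i => [|gc gcs IH] [|i] //=; first by case=> h1 h2 _ [E]; rewrite E in h1 h2.
by case=> _ _; apply: IH.
Qed.

Lemma exec_grow (x : input) (c : command) s res :
  exec x c s res -> increasing_command c ->
  if res is Some s' then s.1 \subset s'.1 /\ s.2 \subset s'.2 else True.
Proof.
elim=> {c s res} //=.
- by move=> os q o _; rewrite subsetUl.
- by move=> r a q o _; rewrite subsetUr.
- move=> c1 c2 s s' [s''|] // _ IH1 _ IH2 [/IH1[h1 h2] /IH2[h3 h4]].
  by split; [apply: subset_trans h1 h3 | apply: subset_trans h2 h4].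
by move=> gcs i g c s res E H _ IH [_ /increasing_branch/(_ E)[_ /IH]].
Qed.

(** Programs are loop-free and a block without a true guard is skipped, so no run gets stuck. This
    completes a run past the command of interest. *)
Lemma exec_total (x : input) (c : command) s : exists res, exec x c s res.
Proof.
elim/command_nested_ind: c s => [os||r a|r a|c1 c2 IH1 IH2|gcs IH] [q o];
  try by eexists; constructor.
- have [[s'|] E1] := IH1 (q, o); last by exists None; apply: ExecSeqAbort.
  have [res E2] := IH2 s'; exists res; exact: ExecSeq E1 E2.
case E: (all (fun gc => ~~ holds x q gc.1) gcs).
  by exists (Some (q, o)); apply: ExecBlockSkip.
have [i [g [c [E1 E2 [res E3]]]]] : exists i g c,
    [/\ onth gcs i = Some (g, c), holds x q g & exists res, exec x c (q, o) res].
  elim: gcs IH E => //= -[g c] gcs IH [Hc /IH{}IH].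
  case: (boolP (holds x q g)) => [Hg _|_ /IH[i [g' [c' [h1 h2 h3]]]]].
    by exists 0, g, c; split.
  by exists i.+1, g', c'; split.
by exists res; apply: (ExecBlock E1 _ E3).
Qed.

(** The larger state can take the same branches, whose guards stay true. It may abort where the
    smaller one did not, but an abort of the smaller run is always matched. *)
Lemma exec_mono (x : input) (c : command) s res : exec x c s res -> increasing_command c ->
  forall s2 : pstate, s.1 \subset s2.1 -> s.2 \subset s2.2 ->
  exists2 res2, exec x c s2 res2 &
    if res2 is Some s2' then
      exists2 s', res = Some s' & s'.1 \subset s2'.1 /\ s'.2 \subset s2'.2
    else True.
Proof.
elim=> {c s res}.
- move=> os q o _ [q2 o2] /= h1 h2; eexists; first exact: ExecOutput.
  by eexists; first by []; split; rewrite ?setSU.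
- by move=> s _ s2 _ _; exists None; first exact: ExecAbort.
- move=> r a q o _ [q2 o2] /= h1 h2; eexists; first exact: ExecInsert.
  by eexists; first by []; split; rewrite ?setUS.
- by [].
- move=> c1 c2 s s' res _ IH1 _ IH2 [/= H1 H2] s2 h1 h2.
  have [[s2'|] E1] := IH1 H1 _ h1 h2; last by exists None => //; apply: ExecSeqAbort.
  case=> _ [<-] [h3 h4]; have [res2 E2 H] := IH2 H2 _ h3 h4.
  by exists res2 => //; apply: ExecSeq E1 E2.
- move=> c1 c2 s _ IH [/= H1 _] s2 h1 h2.
  have [[s2'|] E1] := IH H1 _ h1 h2; first by case.
  by exists None => //; apply: ExecSeqAbort.
- move=> gcs i g c s res E Hg _ IH [/= _ /increasing_branch/(_ E)[ng Hc]] s2 h1 h2.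
  have [res2 E2 H] := IH Hc _ h1 h2; exists res2 => //.
  by apply: ExecBlock E _ E2; apply: (holds_sub ng _ Hg).
(* The smaller run skipped the block, while the larger may enter it; any result other than abort
   still contains the starting state. *)
move=> gcs s Hs H s2 h1 h2; have [res2 E2] := exec_total x (Block gcs) s2.
exists res2 => //; case: res2 E2 => // s2' /exec_grow/(_ H)[h3 h4].
by exists s => //; split; [apply: subset_trans h3 | apply: subset_trans h4].
Qed.

Variables (I : Type) (abortI : I) (factI : fact -> I) (outI : input -> I).

(* The items that [c] may produce if its guards are evaluated against the fixed
   valuation [Q]. *)
Fixpoint effect (x : input) (Q : valuation) (c : command) (it : I) : Prop :=
  match c with
  | Output os => exists2 w, List.In w os & it = outI (eval_out x w)
  | Abort => it = abortI
  | Insert r a => it = factI (eval_fact x a)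
  | Remove r a => False
  | Seq c1 c2 => effect x Q c1 it \/ effect x Q c2 it
  | Block gcs =>
      foldr (fun gc P => (holds x Q gc.1 /\ effect x Q gc.2 it) \/ P) False gcs
  end.

Lemma effect_branch x Q gcs i g c it :
  onth gcs i = Some (g, c) -> holds x Q g -> effect x Q c it ->
  effect x Q (Block gcs) it.
Proof.
elim: gcs i => [|gc gcs IH] [|i] //=; first by case=> ->; left.
by move=> h1 h2 h3; right; apply: IH h1 h2 h3.
Qed.

Lemma exec_closed (K : I -> Prop) (x : input) (Q : valuation) (c : command) s res :
  exec x c s res -> increasing_command c -> s.1 \subset Q ->
  (forall it, effect x Q c it -> K it) ->
  (forall f, K (factI f) -> f \in Q) -> ~ K abortI ->
  exists2 s', res = Some s' &
    s'.1 \subset Q /\ forall y, y \in s'.2 -> y \in s.2 \/ K (outI y).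
Proof.
move=> H; elim: H => {c s res}.
- move=> os q o /= _ hq hK _ _; eexists; first by [].
  split=> // y; rewrite !inE => /orP[->|H]; first by left.
  right; apply: hK; elim: os H => //= w os IH; rewrite inE.
  case/orP=> [/eqP->|/IH[w' h ->]]; first by exists w => //; left.
  by exists w' => //; right.
- by move=> s _ _ hK _ hA; case: hA; apply: hK.
- move=> r a q o /= _ hq hK hQ _; eexists; first by [].
  split=> [|y ->]; last by left.
  by rewrite subUset sub1set hq andbT; apply: hQ; apply: hK.
- by [].
- move=> c1 c2 s s' res _ IH1 _ IH2 [/= H1 H2] hq hK hQ hA.
  case: (IH1 H1 hq (fun it h => hK it (or_introl h)) hQ hA) => _ [<-] [h1 h2].
  case: (IH2 H2 h1 (fun it h => hK it (or_intror h)) hQ hA) => s'' -> [h3 h4].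
  by exists s'' => //; split=> // y /h4[/h2|]; [|right].
- move=> c1 c2 s _ IH [/= H1 _] hq hK hQ hA.
  by case: (IH H1 hq (fun it h => hK it (or_introl h)) hQ hA).
- move=> gcs i g c s res E Hg _ IH [/= _ /increasing_branch/(_ E)[ng Hc]] hq hK hQ hA.
  apply: IH => // it h; apply: hK; apply: effect_branch E _ h.
  exact: (holds_sub ng _ Hg).
by move=> gcs s _ _ hq _ _ _; exists s => //; split=> // y; left.
Qed.

Lemma exec_effect (x : input) (Q : valuation) (c : command) it :
  increasing_command c -> effect x Q c it ->
  forall s : pstate, Q \subset s.1 ->
  exists2 res, exec x c s res & if res is Some s' then
    (exists2 f, it = factI f & f \in s'.1) \/ (exists2 y, it = outI y & y \in s'.2)
    else True.
Proof.
elim/command_nested_ind: c => [os||r a|r a|c1 c2 IH1 IH2|gcs IH] //=.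
- move=> _ [w Hw ->] [q o] _; eexists; first exact: ExecOutput.
  right; exists (eval_out x w) => //; rewrite !inE; apply/orP; right.
  elim: os Hw => //= w' os IH; rewrite inE; case=> [->|/IH->]; last by rewrite orbT.
  by rewrite eqxx.
- by move=> _ _ s _; exists None => //; apply: ExecAbort.
- move=> _ -> [q o] _; eexists; first exact: ExecInsert.
  by left; eexists; first by []; rewrite !inE eqxx.
- move=> [H1 H2] [/(IH1 H1) E|/(IH2 H2) E] s hq.
    have [[s'|] E1 w] := E s hq; last by exists None => //; apply: ExecSeqAbort.
    have [res E2] := exec_total x c2 s'; exists res; first exact: ExecSeq E1 E2.
    case: res E2 => // s'' /exec_grow/(_ H2)[/subsetP h1 /subsetP h2].
    by case: w => -[y -> /= Hy]; [left | right]; exists y => //; auto.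
  have [[s'|] E1] := exec_total x c1 s; last by exists None => //; apply: ExecSeqAbort.
  have /= [h1 _] := exec_grow E1 H1.
  have [res E2 w] := E s' (subset_trans hq h1); exists res => //.
  exact: ExecSeq E1 E2.
move=> [_ H] He s hq.
have [i [g [c [E Hg Hx]]]] : exists i g c, [/\ onth gcs i = Some (g, c), holds x s.1 g &
    exists2 res, exec x c s res & if res is Some s' then
    (exists2 f, it = factI f & f \in s'.1) \/ (exists2 y, it = outI y & y \in s'.2)
    else True].
  elim: gcs IH H He => //= -[g c] gcs IH [Hc /IH{}IH] [/= ng inc /IH{}IH].
  case=> [[Hg He]|/IH[i [g' [c' H]]]]; last by exists i.+1, g', c'.
  exists 0, g, c; split=> //; last exact: Hc.
  exact: (holds_sub ng _ Hg).
have [res Hr w] := Hx; exists res => //.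
exact: ExecBlock E Hg Hr.
Qed.

End Programs.

(** * Saturation decides safety *)

Section Saturation.

Variable N : network.

Definition mfact (m : 'I_(mboxes N)) : finType :=
  fact (hosts N) (tags N) (port m) (@signature _ _ _ (mbox m)).

Definition item : finType :=
  option ({m : 'I_(mboxes N) & mfact m} + node N * node N * pkt N).

Definition abortI : item := None.
Definition factI (m : 'I_(mboxes N)) (f : mfact m) : item :=
  Some (inl (Tagged mfact f)).
Definition chanI (z : node N * node N * pkt N) : item := Some (inr z).
Definition outI (m : 'I_(mboxes N)) (y : pkt N * port m) : item :=
  chanI (inr m, val y.2, y.1).

Definition known (ks : seq item) (m : 'I_(mboxes N)) : mstate (mbox m) :=
  [set f | factI f \in ks].

Definition effects (m : 'I_(mboxes N)) (x : pkt N * port m) (q : mstate (mbox m)) :=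
  effect abortI (@factI m) (@outI m) x q (program (mbox m)).

Variant derives (ks : seq item) : item -> Prop :=
| DerInit m f : f \in initial (mbox m) -> derives ks (@factI m f)
| DerSend h v p : adj (inl h) v -> p \in sendable h ->
    derives ks (chanI (inl h : node N, v, p))
| DerProcess m (v : port m) p it : chanI (val v, inr m : node N, p) \in ks ->
    effects (p, v) (known ks m) it -> derives ks it.

Hypothesis incr : syntactically_increasing N.

Lemma set_mstate_same (s : mstates N) m q : set_mstate s (m := m) q m = q.
Proof. exact: dfwith_in. Qed.

Lemma set_mstate_other (s : mstates N) m q m' :
  m != m' -> set_mstate s (m := m) q m' = s m'.
Proof. exact: dfwith_out. Qed.

(** Invariant: every relation state is included in the known facts and every pending packet is a
    known item; closure preserves this and rules out abort. *)
Lemma saturated_safe ks :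
  (forall it, derives ks it -> it \in ks) -> abortI \notin ks -> safe N.
Proof.
move=> closed noabort.
suff inv c : reachable c ->
    (forall m, exists2 q, c.2 m = Some q & q \subset known ks m) /\
    (forall z, 0 < c.1 z -> chanI z \in ks).
  by move=> c /inv[H _] m; have [q -> _] := H m.
have run m (v : port m) p (q : mstate (mbox m)) res :
    chanI (val v, inr m : node N, p) \in ks -> q \subset known ks m ->
    exec (p, v) (program (mbox m)) (q, set0) res ->
    exists2 s', res = Some s' & s'.1 \subset known ks m /\
      forall y, y \in s'.2 -> outI y \in ks.
  move=> Hc Hq He.
  case: (exec_closed (K := fun it => it \in ks) He (incr m) Hq
    (abortI := abortI) (factI := @factI m) (outI := @outI m)).
  - by move=> it Hit; apply: closed; apply: DerProcess Hc Hit.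
  - by move=> f; rewrite inE.
  - exact/negP.
  move=> s' -> [h1 h2]; exists s' => //; split=> // y /h2[] //.
  by rewrite inE.
elim=> {c} [|c c' _ [IH1 IH2]] /=.
  split=> [m|z]; last by rewrite ffunE.
  exists (initial (mbox m)) => //; apply/subsetP => f Hf; rewrite inE.
  by apply: closed; apply: DerInit.
move=> st; case: st IH1 IH2 => {c c'}
  [c s h v p Ha Hp|c s m v p q q' o Hs Hc He|c s m v p q Hs Hc He] /= IH1 IH2.
- split=> // z; rewrite ffunE inE; case: eqP => [-> _|_]; last first.
    by rewrite addn0; apply: IH2.
  by apply: closed; apply: DerSend.
- have [q0] := IH1 m; rewrite Hs => -[<-] Hq.
  have [_ [<-] [/= h1 h2]] := run _ _ _ _ _ (IH2 _ Hc) Hq He.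
  split=> [m'|z].
    case: (eqVneq m m') => [<-|ne]; last by rewrite set_mstate_other.
    by rewrite set_mstate_same; exists q'.
  rewrite !ffunE; case: (boolP (z \in egress o)) => [/imsetP[y Hy ->] _|_].
    exact: h2 Hy.
  by rewrite addn0 => H; apply: IH2; apply: leq_trans H (leq_subr _ _).
have [q0] := IH1 m; rewrite Hs => -[<-] Hq.
by have [] := run _ _ _ _ _ (IH2 _ Hc) Hq He.
Qed.

(** * Realising all generated items in one configuration *)

Inductive generated : seq item -> Prop :=
| GenNil : generated [::]
| GenCons ks it : generated ks -> derives ks it -> generated (it :: ks).

Hypothesis Nsafe : safe N.

Lemma reachable_state (c : config N) (m : 'I_(mboxes N)) : reachable c ->
  exists2 q, c.2 m = Some q & initial (mbox m) \subset q.
Proof.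
move=> Hr; move: (Nsafe Hr (m := m)); elim: Hr => {c} [|c c' Hr IH st] H.
  by exists (initial (mbox m)).
have [q1 E1 S1] := IH (Nsafe Hr (m := m)).
case: st E1 H => {c c' Hr IH}
  [c s h v p Ha Hp|c s m' v p q q' o Hs Hc He|c s m' v p q Hs Hc He] /= E1.
- by exists q1.
- case: (eqVneq m' m) => [E|ne]; last by rewrite set_mstate_other // E1; exists q1.
  case: m / E q1 E1 S1 => q1; rewrite Hs => -[<-] S1 _.
  rewrite set_mstate_same; exists q' => //.
  by apply: subset_trans S1 _; have /= [] := exec_grow He (incr m').
case: (eqVneq m' m) => [E|ne]; last by rewrite set_mstate_other // E1; exists q1.
by case: m / E q1 E1 S1 => q1 _ _; rewrite set_mstate_same.
Qed.

(* An execution can be replayed from any reachable configuration: the larger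
   relations only produce more. *)
Lemma replay (a b : config N) : reachable a -> reachable b ->
  exists c, [/\ reachable c, forall z, a.1 z + b.1 z <= c.1 z,
    forall m q, a.2 m = Some q -> exists2 q', c.2 m = Some q' & q \subset q' &
    forall m q, b.2 m = Some q -> exists2 q', c.2 m = Some q' & q \subset q'].
Proof.
move=> Ha Hb; elim: Ha => {a} [|a a' Ha [[cc cs] [Hc Hz Hma Hmb]] st].
  exists b; split=> //.
  - by move=> z; rewrite ffunE.
  - by move=> m q [<-]; apply: reachable_state.
  by move=> m q E; exists q.
case: st Ha Hz Hma => {a a'}
  [ca s h v p Hadj Hp|ca s m v p q q' o Hs Hca He|ca s m v p q Hs Hca He] Ha /= Hz Hma.
- exists (enqueue cc [set (inl h : node N, v, p)], cs); split=> //=.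
    by apply: ReachStep Hc _; apply: StepSend.
  by move=> z; rewrite !ffunE addnAC leq_add2r.
- have [q2 E2 S2] := Hma _ _ Hs.
  have Hcc : 0 < cc (val v, inr m, p).
    by apply: leq_trans Hca (leq_trans (leq_addr _ _) (Hz _)).
  (* The step is mirrored in the larger relations; the other outcome, an abort of the mirrored step,
     contradicts safety. *)
  have [[[q2' o2]|] He2 /=] := exec_mono He (incr m) (s2 := (q2, set0)) S2 (subxx _).
    case=> _ [<-] /= [Sq So].
    have Hr := ReachStep Hc (StepProcess E2 Hcc He2).
    eexists; split; first exact: Hr.
    - move=> z /=; rewrite !ffunE.
      have : (z \in egress o) <= (z \in egress o2).
        case: imsetP => [[y Hy ->]|_] //=; rewrite leqNgt ltnS leqn0 eqb0 negbK.
        by apply/imsetP; exists y => //; apply: (subsetP So).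
      (* The consumed copy [e] comes out of the share [a] of the replayed run, so the truncated
         subtraction takes nothing from [b']. *)
      have arith a b' c u w e :
          e <= a -> a + b' <= c -> u <= w -> a - e + u + b' <= c - e + w by lia.
      by apply: arith (Hz z); case: eqP => // ->.
    - move=> m' r /=; case: (eqVneq m m') => [E|ne]; last first.
        by rewrite !set_mstate_other //; apply: Hma.
      by case: m' / E r => r; rewrite !set_mstate_same => -[<-]; exists q2'.
    move=> m' r Hr' /=; case: (eqVneq m m') => [E|ne]; last first.
      by rewrite !set_mstate_other //; apply: Hmb.
    case: m' / E r Hr' => r Hr'; rewrite !set_mstate_same; exists q2' => //.
    have [r' E' Sr] := Hmb _ _ Hr'; move: E'; rewrite /= E2 => -[Eq].
    apply: subset_trans Sr _; rewrite -Eq.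
    by have /= [] := exec_grow He2 (incr m).
  move=> _; have Hr := ReachStep Hc (StepAbort E2 Hcc He2).
  by case: (Nsafe Hr (m := m)); rewrite /= set_mstate_same.
have Hr := ReachStep Ha (StepAbort Hs Hca He).
by case: (Nsafe Hr (m := m)); rewrite /= set_mstate_same.
Qed.

Definition justified (c : config N) (it : item) : Prop :=
  match it with
  | None => False
  | Some (inl f) => exists2 q, c.2 (tag f) = Some q & tagged f \in q
  | Some (inr z) => 0 < c.1 z
  end.

(** The items must hold in one common configuration: the next derivation needs its packet and all
    facts read by its guards at the same time. *)
Lemma generated_justified ks : generated ks ->
  exists2 c : config N, reachable c & forall it, it \in ks -> justified c it.
Proof.
elim=> {ks} [|ks it _ [c Hc Hj]]; first by exists (init_config N) => //; apply: ReachInit.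
case=> {it} [m f Hf|h v p Ha Hp|m v p it Hin He].
- have [q E S] := reachable_state m Hc; exists c => // it.
  rewrite inE => /orP[/eqP->|/Hj //]; exists q => //.
  exact: (subsetP S).
- exists (enqueue c.1 [set (inl h : node N, v, p)], c.2).
    by apply: ReachStep (Hc) _; case: (c) => *; apply: StepSend.
  move=> it; rewrite inE => /orP[/eqP->|/Hj].
    by rewrite /= ffunE !inE eqxx addn1.
  by case: it => [[//|z]|//] /=; rewrite ffunE => Hz; apply: leq_trans Hz (leq_addr _ _).
(* Replaying the run on itself doubles every pending packet, so one copy can be processed while the
   packet item remains justified. *)
have [[dc ds] [Hd Hz Hm _]] := replay Hc Hc; rewrite /= in Hz Hm.
have [q0 E0 _] := reachable_state m Hc.
have [q Eq Sq] := Hm _ _ E0.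
have cpos : 0 < c.1 (val v, inr m, p) by apply: (Hj _ Hin).
have dpos : 0 < dc (val v, inr m, p).
  by apply: leq_trans cpos (leq_trans (leq_addr _ _) (Hz _)).
have Kq : known ks m \subset q.
  apply/subsetP => f; rewrite inE => /Hj[r /= Er Hf].
  by move: Er; rewrite E0 => -[Er]; apply: (subsetP Sq); rewrite Er.
have [[[q' o]|] Hx /=] := exec_effect (incr m) He (s := (q, set0)) Kq; last first.
  move=> _; have Hr := ReachStep Hd (StepAbort Eq dpos Hx).
  by case: (Nsafe Hr (m := m)); rewrite /= set_mstate_same.
have Hr := ReachStep Hd (StepProcess Eq dpos Hx).
have /= [Sq' _] := exec_grow Hx (incr m).
move=> w; eexists; first exact: Hr.
move=> it'; rewrite inE => /orP[/eqP->|/Hj].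
  case: w => [[f -> Hf]|[y -> Hy]].
    by exists q'; rewrite //= set_mstate_same.
  rewrite /= !ffunE; apply: leq_trans (leq_addl _ _).
  by rewrite lt0b; apply/imsetP; exists y.
case: it' => [[[m' f]|z]|//] /=.
  case=> r Er Hf; have [r' Er' Sr] := Hm _ _ Er.
  case: (eqVneq m m') => [E|ne]; last first.
    by exists r'; rewrite ?set_mstate_other // (subsetP Sr).
  case: m' / E f r Er Hf r' Er' Sr => f r Er Hf r' Er' Sr.
  exists q'; rewrite ?set_mstate_same //.
  apply: (subsetP Sq'); move: Er'; rewrite Eq => -[->]; exact: (subsetP Sr).
move=> Hcz; rewrite !ffunE; apply: leq_trans (leq_addr _ _).
have arith a b' e : 0 < a -> a + a <= b' -> e <= 1 -> 0 < b' - e by lia.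
by apply: arith Hcz (Hz z) _; case: eqP.
Qed.

Lemma generated_no_abort ks : generated ks -> abortI \notin ks.
Proof. by move=> /generated_justified[c _ H]; apply/negP => /H. Qed.

End Saturation.

(** * The algorithm computes the saturation *)

Lemma tnat_inj : injective tnat.
Proof. by elim=> [|n IH] [|m] //= [/IH->]. Qed.

Lemma inT_tseq (A : eqType) (f : A -> tree) o s :
  inT o (tseq f s) <-> exists2 a, a \in s & o = f a.
Proof.
elim: s => [|a s IH] /=; first by split=> // -[].
rewrite IH; split.
  case=> [->|[b bs ->]]; first by exists a => //; rewrite mem_head.
  by exists b => //; rewrite inE bs orbT.
case=> b; rewrite inE => /orP[/eqP->|bs] ->; first by left.
by right; exists b.
Qed.

Lemma tseq_tlist (A : Type) (f : A -> tree) s : tseq f s = tlist [seq f a | a <- s].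
Proof. by elim: s => //= a s ->. Qed.

(** With [phi] the coding of items, this translates the trees collected by the algorithm back into
    items. *)
Lemma effect_map nH nT Pt nR (sig : 'I_nR -> seq sort) (I J : Type) (phi : I -> J)
    a f g x Q (c : command nH nT Pt sig) o :
  effect (phi a) (fun y => phi (f y)) (fun y => phi (g y)) x Q c o <->
  exists2 it, effect a f g x Q c it & o = phi it.
Proof.
elim/command_nested_ind: c => [os||r b|r b|c1 c2 IH1 IH2|gcs IH] /=.
- split=> [[w Hw ->]|[it [w Hw ->] ->]]; last by exists w.
  by exists (g (eval_out x w)) => //; exists w.
- by split=> [->|[it -> ->]] //; exists a.
- by split=> [->|[it -> ->]] //; eexists.
- by split=> // -[].
- rewrite IH1 IH2; split=> [[]|] [it].
  + by move=> H ->; exists it => //; left.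
  + by move=> H ->; exists it => //; right.
  by move=> [H|H] ->; [left | right]; exists it.
elim: gcs IH => [_|[h c] gcs IHg [/= IHc /IHg ->]] /=; first by split=> // -[].
rewrite IHc; split=> [[[Hh]|]|] [it].
- by move=> H ->; exists it => //; left.
- by move=> H ->; exists it => //; right.
by move=> [[Hh H]|H] ->; [left; split=> // | right]; exists it.
Qed.

(** * Unfolding equations of the tree algorithms *)

Arguments guardT : simpl never.
Arguments effT : simpl never.
Arguments mapT : simpl never.
Arguments eqT : simpl never.
Arguments memT : simpl never.
Arguments appT : simpl never.
Arguments gather : simpl never.

(** These equations hold by evaluating the tag; the nested [ift _ yesT Leaf] come from the
    normalisation in [brec], once for each node passed. *)
Lemma guardT_eq E t1 t2 : guardT (Cons Leaf E) (tlist [:: tnat 0; t1; t2]) =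
  ift (eqT (termT E t1) (termT E t2)) yesT Leaf.
Proof. by []. Qed.

Lemma guardT_mem E r a : guardT (Cons Leaf E) (tlist [:: tnat 1; r; a]) =
  ift (memT (factT E r a) (eK E)) yesT Leaf.
Proof. by []. Qed.

Lemma guardT_not E g : guardT (Cons Leaf E) (tlist [:: tnat 2; g]) =
  ift (ift (ift (guardT (Cons Leaf E) g) Leaf yesT) yesT Leaf) yesT Leaf.
Proof. by []. Qed.

Lemma guardT_and E g1 g2 : guardT (Cons Leaf E) (tlist [:: tnat 3; g1; g2]) =
  ift (ift (ift (guardT (Cons Leaf E) g1)
    (ift (ift (guardT (Cons Leaf E) g2) yesT Leaf) yesT Leaf) Leaf) yesT Leaf) yesT Leaf.
Proof. by []. Qed.

Lemma guardT_or E g1 g2 : guardT (Cons Leaf E) (tlist [:: tnat 4; g1; g2]) =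
  ift (ift (ift (guardT (Cons Leaf E) g1) yesT
    (ift (ift (guardT (Cons Leaf E) g2) yesT Leaf) yesT Leaf)) yesT Leaf) yesT Leaf.
Proof. by []. Qed.

Lemma effT_Leaf t : effT Leaf t = Leaf.
Proof. exact: gather_Leaf. Qed.

Lemma inT_effT o a E x y : let p := Cons a E in let t := Cons x y in
  inT o (effT p t) <-> inT o (eff_own p t) \/
  inT o (effT (eff_left p t) x) \/ inT o (effT (eff_right p t) y).
Proof. exact: inT_gather. Qed.

Lemma inT_effT_output o E os :
  inT o (effT (Cons Leaf E) (tlist [:: tnat 0; os])) <-> inT o (mapT outT E os).
Proof.
have H : inT o (effT (Cons Leaf E) (tlist [:: tnat 0; os])) <->
    inT o (mapT outT E os) \/ inT o (effT Leaf (tnat 0)) \/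
    inT o (effT Leaf (tlist [:: os])) by exact: inT_effT.
by rewrite H !effT_Leaf /=; tauto.
Qed.

Lemma inT_effT_abort o E :
  inT o (effT (Cons Leaf E) (tlist [:: tnat 1])) <-> o = Leaf.
Proof.
have H : inT o (effT (Cons Leaf E) (tlist [:: tnat 1])) <->
    (o = Leaf \/ False) \/ inT o (effT Leaf (tnat 1)) \/ inT o (effT Leaf Leaf)
  by exact: inT_effT.
by rewrite H !effT_Leaf /=; tauto.
Qed.

Lemma inT_effT_insert o E r a :
  inT o (effT (Cons Leaf E) (tlist [:: tnat 2; r; a])) <-> o = factT E r a.
Proof.
have H : inT o (effT (Cons Leaf E) (tlist [:: tnat 2; r; a])) <->
    (o = factT E r a \/ False) \/ inT o (effT Leaf (tnat 2)) \/
    inT o (effT Leaf (tlist [:: r; a])) by exact: inT_effT.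
by rewrite H !effT_Leaf /=; tauto.
Qed.

Lemma inT_effT_remove o E r a :
  inT o (effT (Cons Leaf E) (tlist [:: tnat 3; r; a])) <-> False.
Proof.
have H : inT o (effT (Cons Leaf E) (tlist [:: tnat 3; r; a])) <->
    False \/ inT o (effT Leaf (tnat 3)) \/ inT o (effT Leaf (tlist [:: r; a]))
  by exact: inT_effT.
by rewrite H !effT_Leaf /=; tauto.
Qed.

Lemma inT_effT_args o E c l :
  inT o (effT (Cons (tnat 1) E) (Cons c l)) <->
  inT o (effT (Cons Leaf E) c) \/ inT o (effT (Cons (tnat 1) E) l).
Proof.
have H : inT o (effT (Cons (tnat 1) E) (Cons c l)) <->
    False \/ inT o (effT (Cons Leaf E) c) \/ inT o (effT (Cons (tnat 1) E) l)
  by exact: inT_effT.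
by rewrite H; tauto.
Qed.

Lemma inT_effT_seq o E c1 c2 :
  inT o (effT (Cons Leaf E) (tlist [:: tnat 4; c1; c2])) <->
  inT o (effT (Cons Leaf E) c1) \/ inT o (effT (Cons Leaf E) c2).
Proof.
have H : inT o (effT (Cons Leaf E) (tlist [:: tnat 4; c1; c2])) <->
    False \/ inT o (effT Leaf (tnat 4)) \/
    inT o (effT (Cons (tnat 1) E) (tlist [:: c1; c2])) by exact: inT_effT.
have H' : inT o (effT (Cons (tnat 1) E) Leaf) <-> False by exact: inT_gather_Leaf.
by rewrite H !effT_Leaf !inT_effT_args H' /=; tauto.
Qed.

Lemma inT_effT_nil o E : inT o (effT (Cons (tnat 3) E) Leaf) <-> False.
Proof. exact: inT_gather_Leaf. Qed.

Lemma inT_effT_branch o E g c l :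
  inT o (effT (Cons (tnat 3) E) (Cons (Cons g c) l)) <->
  (truth (guardT (Cons Leaf E) g) /\ inT o (effT (Cons Leaf E) c)) \/
  inT o (effT (Cons (tnat 3) E) l).
Proof.
have H : inT o (effT (Cons (tnat 3) E) (Cons (Cons g c) l)) <->
    False \/ inT o (effT (Cons (tnat 4) E) (Cons g c)) \/
    inT o (effT (Cons (tnat 3) E) l) by exact: inT_effT.
have H' : inT o (effT (Cons (tnat 4) E) (Cons g c)) <->
    False \/ inT o (effT Leaf g) \/
    inT o (effT (ift (guardT (Cons Leaf E) g) (Cons Leaf E) Leaf) c)
  by exact: inT_effT.
by rewrite H H' iftE; case: truth; rewrite !effT_Leaf /=; intuition.
Qed.

Lemma inT_effT_block o E l :
  inT o (effT (Cons Leaf E) (tlist [:: tnat 5; l])) <->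
  inT o (effT (Cons (tnat 3) E) l).
Proof.
have H : inT o (effT (Cons Leaf E) (tlist [:: tnat 5; l])) <->
    False \/ inT o (effT Leaf (tnat 5)) \/
    inT o (effT (Cons (tnat 2) E) (Cons l Leaf)) by exact: inT_effT.
have H' : inT o (effT (Cons (tnat 2) E) (Cons l Leaf)) <->
    False \/ inT o (effT (Cons (tnat 3) E) l) \/ inT o (effT Leaf Leaf)
  by exact: inT_effT.
by rewrite H H' !effT_Leaf /=; tauto.
Qed.

Section Middlebox.

Variables (nH nT : nat) (Pt : finType) (tport : Pt -> tree).
Hypothesis tport_inj : injective tport.

Lemma tdom_inj s : injective (@tdom nH nT Pt tport s).
Proof. by case: s => //= i j /tnat_inj/val_inj. Qed.

Lemma ttuple_inj sg : injective (@ttuple nH nT Pt tport sg).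
Proof.
elim: sg => [|s sg IH] /=; first by case=> -[].
by move=> [a b] [c d] /= [/tdom_inj-> /IH->].
Qed.

Variables (nR : nat) (sig : 'I_nR -> seq sort).

Lemma tfact_inj : injective (@tfact nH nT Pt tport nR sig).
Proof.
move=> [r t] [r' t'] /= [/tnat_inj/val_inj E]; case: r' / E t' => t'.
by rewrite /Tagged /= => /ttuple_inj->.
Qed.

Variables (K : tree) (m : nat) (p : packet nH nT) (v : Pt).
Let E := envT K (tnat m) (tport v) (tpacket p).
Let x := (p, v).

Lemma termTE s (t : term nH nT Pt s) : termT E (tterm tport t) = tdom tport (eval_term x t).
Proof. by case: t. Qed.

Lemma argsTE sg (a : args nH nT Pt sg) :
  mapT termT E (targs tport a) = ttuple tport (eval_args x a).
Proof.
elim: sg a => [|s sg IH] a //=.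
by rewrite mapT_Cons termTE IH.
Qed.

Let fcode (f : fact nH nT Pt sig) : tree := Cons Leaf (Cons (tnat m) (tfact tport f)).
Let ocode (y : packet nH nT * Pt) : tree :=
  Cons (Cons (Cons (tnat 1) (tnat m)) (tport y.2)) (tpacket y.1).

Lemma factTE r (a : args nH nT Pt (sig r)) :
  factT E (tnat r) (targs tport a) = fcode (eval_fact x a).
Proof. by rewrite /factT argsTE. Qed.

Variable Q : valuation nH nT Pt sig.
Hypothesis KQ : forall f, inT (fcode f) K <-> f \in Q.

Lemma guardTE (g : guard nH nT Pt sig) :
  truth (guardT (Cons Leaf E) (tguard tport g)) = holds x Q g.
Proof.
elim: g => [s t1 t2|r a|g IH|g1 IH1 g2 IH2|g1 IH1 g2 IH2].
- rewrite [tguard _ _]/= guardT_eq truth_ift !termTE [RHS]/=.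
  by case: eqTP => [/tdom_inj->|ne]; rewrite ?eqxx //; case: eqP => // e; case: ne; rewrite e.
- rewrite [tguard _ _]/= guardT_mem truth_ift factTE [RHS]/=.
  by case: memTP => H; [rewrite (proj1 (KQ _) H) | case: (boolP (_ \in Q)) => // /KQ].
- by rewrite [tguard _ _]/= guardT_not !truth_ift IH [RHS]/=; case: holds.
- rewrite [tguard _ _]/= guardT_and !truth_ift IH1 IH2 [RHS]/=.
  by case: holds => //; case: holds.
rewrite [tguard _ _]/= guardT_or !truth_ift IH1 IH2 [RHS]/=.
by case: holds => //; case: holds.
Qed.

Lemma outTE w : outT E (tout tport w) = ocode (eval_out x w).
Proof.
have -> : outT E (tout tport w) =
  Cons (Cons (Cons (tnat 1) (tnat m)) (termT E (tterm tport w.2)))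
    (tlist [:: termT E (tterm tport w.1.1.1); termT E (tterm tport w.1.1.2);
               termT E (tterm tport w.1.2)]) by [].
by rewrite !termTE.
Qed.

Lemma effTE (c : command nH nT Pt sig) o :
  inT o (effT (Cons Leaf E) (tcommand tport c)) <-> effect Leaf fcode ocode x Q c o.
Proof.
elim/command_nested_ind: c o => [os||r a|r a|c1 c2 IH1 IH2|gcs IH] o;
  rewrite [tcommand _ _]/= [effect _ _ _ _ _ _ _]/=.
- rewrite inT_effT_output inT_mapT; split.
    case=> t Ht ->; elim: os Ht => //= w os IH [->|/IH[w' H ->]].
      by exists w; [left | rewrite outTE].
    by exists w' => //; right.
  case=> w Hw ->; exists (tout tport w); last by rewrite outTE.
  by elim: os Hw => //= w' os IH [->|/IH]; [left | right].
- exact: inT_effT_abort.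
- by rewrite inT_effT_insert factTE.
- exact: inT_effT_remove.
- by rewrite inT_effT_seq IH1 IH2.
rewrite inT_effT_block; elim: gcs IH => [_|[g c] gcs IHg [/= IHc /IHg{}IHg]] /=.
  exact: inT_effT_nil.
by rewrite inT_effT_branch guardTE IHg IHc.
Qed.

End Middlebox.

Lemma inT_cmapi_enum n (F : 'I_n -> tree) f e o :
  inT o (cmapi f e (tseq F (enum 'I_n))) <->
  exists j : 'I_n, inT o (f (Cons (tnat j) e) (F j)).
Proof.
rewrite tseq_tlist inT_cmapi; split.
  case=> i [a []]; rewrite onth_map; case E: (onth _ i) => [j|] // [<-] H.
  exists j; have lt : i < n by rewrite -[n]size_enum_ord -onthTE E.
  by have /(congr1 (@nat_of_ord n)) := onth_nth j _ _ _ E; rewrite nth_enum_ord // => <-.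
case=> j H; exists j, (F j); split=> //; rewrite onth_map.
have := odflt_onth j (enum 'I_n) j; have := onthTE (enum 'I_n) j.
by rewrite size_enum_ord ltn_ord nth_ord_enum; case: onth => //= _ _ ->.
Qed.

Section Network.

Variable N : network.

Lemma tnode_inj : injective (@tnode N).
Proof. by move=> [h|m] [h'|m'] //= [/tnat_inj/val_inj->]. Qed.

Lemma tpacket_inj : injective (@tpacket (hosts N) (tags N)).
Proof.
move=> [[a b] c] [[a' b'] c'] /=.
by rewrite /tpacket /= => -[/tnat_inj/val_inj-> /tnat_inj/val_inj-> /tnat_inj/val_inj->].
Qed.

Definition tport (m : 'I_(mboxes N)) (v : port m) : tree := tnode (val v).

Lemma tport_inj m : injective (@tport m).
Proof. by move=> u v /tnode_inj/val_inj. Qed.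

Definition code (it : item N) : tree :=
  match it with
  | None => Leaf
  | Some (inl f) => Cons Leaf (Cons (tnat (tag f)) (tfact (@tport (tag f)) (tagged f)))
  | Some (inr (u, v, p)) => Cons (Cons (tnode u) (tnode v)) (tpacket p)
  end.

(** The algorithm compares codes only; injectivity turns this into comparison of items. *)
Lemma code_inj : injective code.
Proof.
move=> [[[m f]|[[u v] p]]|] [[[m' f']|[[u' v'] p']]|] //=.
  move=> H; have E : m = m' by case: H => /tnat_inj/val_inj.
  case: m' / E f' H => f' H.
  by have /(tfact_inj (@tport_inj m)) /= -> := congr1 (fun t => tl (tl t)) H.
move=> H; have /= /tpacket_inj-> := congr1 tl H.
have /= /tnode_inj-> := congr1 (fun t => hd (hd t)) H.
by have /= /tnode_inj-> := congr1 (fun t => tl (hd t)) H.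
Qed.

(** A port of [m] is a node with a proof of adjacency, whereas a channel item carries just the node;
    this invariant supplies the proof. *)
Definition adjacent (ks : seq (item N)) : Prop :=
  forall u v p, chanI (u, v, p) \in ks -> adj u v.

Lemma derives_adjacent ks it : derives ks it -> adjacent ks -> adjacent (it :: ks).
Proof.
move=> D A u v p; rewrite inE => /orP[/eqP E|]; last exact: A.
case: it / D E => [m f _|h w q Ha _ [-> -> _] //|m w q it _] //.
rewrite /effects; move: (program _) => c.
elim/command_nested_ind: c => [os||r a|r a|c1 c2 IH1 IH2|gcs IH] //=.
- by move=> [y _ ->] [-> -> _]; apply: valP.
- by move=> ->.
- by move=> ->.
- by case; auto.
by elim: gcs IH => //= -[g c] gcs IHg [/= IHc /IHg{}IHg] [[_ /IHc]|/IHg].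
Qed.

Section Candidates.

Variable ks : seq (item N).
Hypothesis adjk : adjacent ks.
Notation K := (tseq code ks).

Lemma inT_code it : inT (code it) K <-> it \in ks.
Proof.
rewrite inT_tseq; split=> [[it' H /code_inj->] //|H]; by exists it.
Qed.

Lemma inT_sendT o : let net := tnetwork N in
  inT o (sendT (nd 3 net) (nd 4 net)) <->
  exists h v p, [/\ adj (inl h) v, p \in sendable h &
                    o = code (chanI (inl h : node N, v, p))].
Proof.
rewrite /= /sendT; set ed := nd 3 _; set se := nd 4 _.
have -> : se = tseq (fun h => tseq (@tpacket _ _) (enum (sendable h))) (enum 'I_(hosts N)) by [].
have -> : ed = tseq (fun e : node N * node N => Cons (tnode e.1) (tnode e.2))
  (enum [set e : node N * node N | adj e.1 e.2]) by [].
rewrite inT_cmapi_enum; split.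
  case=> h /inT_cmapT[_ /inT_tseq[p Hp ->]] /inT_cmapT[_ /inT_tseq[[u v] Hv ->]] /=.
  rewrite iftE; case: eqTP => //= E [->|//].
  have Eu : u = inl h by apply: tnode_inj.
  by exists h, v, p; rewrite Eu !mem_enum !inE /= in Hp Hv *.
case=> h [v [p [Ha Hp ->]]]; exists h; apply/inT_cmapT.
exists (tpacket p); first by apply/inT_tseq; exists p => //; rewrite mem_enum.
apply/inT_cmapT; exists (Cons (tnode (inl h : node N)) (tnode v)).
  by apply/inT_tseq; exists (inl h, v) => //; rewrite mem_enum inE.
by rewrite /= iftE; case: eqTP => //= _; left.
Qed.

Lemma inT_mboxT (m : 'I_(mboxes N)) o :
  inT o (mboxT (Cons (tnat m) K) (tmiddlebox (@tport m) (mbox m))) <->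
  (exists2 f, f \in initial (mbox m) & o = code (factI f)) \/
  (exists (v : port m) p it, [/\ chanI (val v, inr m : node N, p) \in ks,
     effects (p, v) (known ks m) it & o = code it]).
Proof.
rewrite /mboxT inT_appT.
have -> : nd 2 (tmiddlebox (@tport m) (mbox m)) =
  tseq (@tfact _ _ _ (@tport m) _ _) (enum (initial (mbox m))) by [].
have -> : nd 1 (tmiddlebox (@tport m) (mbox m)) = tcommand (@tport m) (program (mbox m)) by [].
have EF v p o' : inT o' (effT (Cons Leaf (envT K (tnat m) (@tport m v) (tpacket p)))
    (tcommand (@tport m) (program (mbox m)))) <->
    exists2 it, effects (p, v) (known ks m) it & o' = code it.
  have KQ (f : mfact m) : inT (Cons Leaf (Cons (tnat m) (tfact (@tport m) f))) K <->
      f \in known ks m by rewrite inE; apply: (inT_code (factI f)).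
  apply: iff_trans (effTE (@tport_inj m) p v KQ _ _) _.
  exact: (effect_map code (abortI N) (@factI N m) (@outI N m)).
rewrite inT_mapT inT_cmapT; split.
  case=> [[_ /inT_tseq[f Hf ->] ->]|[_ /inT_tseq[it Hit ->]]].
    by left; exists f => //; rewrite mem_enum in Hf.
  rewrite /recvT; case: it Hit => [[[m' f]|[[u v] p]]|] //= Hit.
  rewrite iftE; case: eqTP => //= E.
  have Ev : v = inr m by apply: tnode_inj.
  rewrite Ev in Hit; have := adjk Hit; rewrite adj_sym => Hadj.
  move/(EF (Sub u Hadj : port m) p) => [it Hi ->].
  by right; exists (Sub u Hadj), p, it.
case=> [[f Hf ->]|[v [p [it [Hin He ->]]]]].
  left; exists (tfact (@tport m) f) => //; apply/inT_tseq; exists f => //.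
  by rewrite mem_enum.
right; exists (code (chanI (val v, inr m : node N, p))).
  by apply/inT_tseq; eexists; first exact: Hin.
rewrite /recvT /= iftE; case: eqTP => //= _.
by apply/(EF v p); exists it.
Qed.

Lemma inT_candT o :
  inT o (candT K (tnetwork N)) <-> exists2 it, derives ks it & o = code it.
Proof.
rewrite /candT inT_appT inT_sendT.
have -> : nd 5 (tnetwork N) =
  tseq (fun m => tmiddlebox (@tport m) (mbox m)) (enum 'I_(mboxes N)) by [].
rewrite inT_cmapi_enum; split.
  case=> [[h [v [p [Ha Hp ->]]]]|[m /inT_mboxT[[f Hf ->]|[v [p [it [H1 H2 ->]]]]]]].
  - by eexists; first exact: DerSend Ha Hp.
  - by eexists; first exact: DerInit Hf.
  by exists it => //; apply: DerProcess H1 H2.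
case=> _ [m f Hf|h v p Ha Hp|m v p it H1 H2] ->.
- by right; exists m; apply/inT_mboxT; left; exists f.
- by left; exists h, v, p.
by right; exists m; apply/inT_mboxT; right; exists v, p, it.
Qed.

Lemma inT_freshT o :
  inT o (freshT K (tnetwork N)) <->
  exists2 it, derives ks it /\ it \notin ks & o = code it.
Proof.
rewrite /freshT inT_cmapT; split.
  case=> _ /inT_candT[it D ->]; rewrite iftE; case: memTP => // H [->|//].
  by exists it => //; split=> //; apply/negP => /inT_code.
case=> it [D H] ->; exists (code it); first by apply/inT_candT; exists it.
rewrite iftE; case: memTP => [/inT_code|_]; last by left.
by rewrite (negPf H).
Qed.

End Candidates.

End Network.

(** * Polynomial bounds *)

Section Loop.

Variable N : network.
Notation net := (tnetwork N).
Notation state ks := (Cons (tseq (@code N) ks) net).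

Definition pending (y : tree) : tree := freshT (hd y) (tl y).

Definition good (ks : seq (item N)) : Prop :=
  [/\ uniq ks, adjacent ks & generated ks].

Lemma round_good ks : good ks ->
  (pending (state ks) = Leaf /\ forall it, derives ks it -> it \in ks) \/
  (pending (state ks) <> Leaf /\
   exists it, good (it :: ks) /\ roundT (state ks) = state (it :: ks)).
Proof.
move=> [U A G]; rewrite /pending /roundT /=.
have FS := inT_freshT A.
case: (freshT _ _) FS => [|o l] FS.
  left; split=> // it D; case: (boolP (it \in ks)) => // H.
  by have /FS : exists2 it', derives ks it' /\ it' \notin ks & code it = code it'
    by exists it.
right; split=> //; have [|it [D H] ->] := (FS o).1; first by left.
exists it; split=> //; split; first by rewrite /= H.
  exact: derives_adjacent.
exact: GenCons.
Qed.

Lemma good_size ks : good ks -> size ks <= #|item N|.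
Proof. by case=> U _ _; rewrite -(card_uniqP U) max_card. Qed.

(** Induction on the number of items still missing: the list has no duplicates, so its length never
    exceeds the number of items. *)
Lemma loop_ends ks : good ks -> exists n ks',
  [/\ size ks + n <= #|item N|, iter n roundT (state ks) = state ks', good ks',
      pending (state ks') = Leaf /\ (forall it, derives ks' it -> it \in ks') &
      forall i, i < n -> pending (iter i roundT (state ks)) <> Leaf /\
        exists2 ks0, good ks0 & iter i roundT (state ks) = state ks0].
Proof.
move En: (#|item N| - size ks) => n; elim: n ks En => [|n IH] ks En g.
  have le := good_size g.
  have [H|[ns [it [g' E]]]] := round_good g; first by exists 0, ks; rewrite addn0; split.
  by have : (size ks).+1 <= #|item N| := good_size g'; move: En le; move: #|_| => M; lia.
have le := good_size g.
have [H|[ns [it [g' E]]]] := round_good g; first by exists 0, ks; rewrite addn0; split.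
have [|n' [ks' [h1 h2 h3 h4 h5]]] := IH (it :: ks) _ g'; first by
  rewrite -[size (_ :: _)]/(size ks).+1; move: En le; move: #|_| => M; lia.
exists n'.+1, ks'; split=> //; first by move: h1; rewrite /= addSnnS.
  by rewrite iterSr E.
case=> [|i] lt; first by split=> //; exists ks.
by rewrite iterSr E; apply: h5.
Qed.

End Loop.

(** * Number and size of items *)

Section Counting.

Variables (k : nat) (N : network).
Hypothesis arity : arity_at_most k N.
Notation n := (sz (tnetwork N)).

Lemma sz_tnat a : sz (tnat a) = a.*2.+1.
Proof. by elim: a => //= a IH; rewrite sz_Cons IH -[sz Leaf]/1; lia. Qed.

Lemma size_tseq (A : Type) (f : A -> tree) s : size s <= sz (tseq f s).
Proof. by elim: s => //= a s IH; rewrite sz_Cons; lia. Qed.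

Lemma sz_inT o l : inT o l -> sz o <= sz l.
Proof.
elim: l => //= a _ l IH; rewrite sz_Cons => -[->|/IH]; last by lia.
by rewrite -addnS leq_addr.
Qed.

Lemma hosts_mboxes_le : hosts N + mboxes N <= n.
Proof.
rewrite /tnetwork /tlist; do 3 rewrite [tseq _ _]/= sz_Cons sz_tnat.
by lia.
Qed.

Lemma tags_le : tags N <= n.
Proof.
rewrite /tnetwork /tlist; do 3 rewrite [tseq _ _]/= sz_Cons sz_tnat.
by lia.
Qed.

Lemma nrel_le (m : 'I_(mboxes N)) : nrel (mbox m) <= n.
Proof.
pose mbs := tseq (fun m => tmiddlebox (@tport N m) (mbox m)) (enum 'I_(mboxes N)).
apply: (@leq_trans (sz mbs)); last first.
  (* The list of middleboxes is the sixth entry of the encoded network. *)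
  by apply: sz_inT; rewrite /tnetwork; do 5 right; left.
apply: (@leq_trans (sz (tmiddlebox (@tport N m) (mbox m)))); last first.
  by apply: sz_inT; apply/inT_tseq; exists m => //; rewrite mem_enum.
rewrite /tmiddlebox /tlist [tseq _ _]/= sz_Cons.
apply: (@leq_trans (sz (tseq (fun r => tseq tsort (signature r))
  (enum 'I_(nrel (mbox m)))))); last by rewrite -addnS leq_addr.
by rewrite -{1}[nrel _]size_enum_ord; apply: size_tseq.
Qed.

Lemma card_dom (m : 'I_(mboxes N)) s :
  #|dom (hosts N) (tags N) (port m) s| <= n.
Proof.
have hm := hosts_mboxes_le; have ht := tags_le.
case: s => /=; rewrite ?card_ord //; first by lia.
rewrite card_sig; apply: leq_trans (max_card _) _.
by rewrite card_sum !card_ord.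
Qed.

Lemma card_tuples (m : 'I_(mboxes N)) sg :
  #|tuples (hosts N) (tags N) (port m) sg| <= n ^ size sg.
Proof.
elim: sg => [|s sg IH] /=; first by rewrite card_unit.
by rewrite card_prod expnS; apply: leq_mul => //; apply: card_dom.
Qed.

Lemma sumn_le (A : Type) (f : A -> nat) s b :
  (forall a, f a <= b) -> sumn [seq f a | a <- s] <= size s * b.
Proof. by move=> H; elim: s => //= a s IH; rewrite mulSn leq_add. Qed.

Lemma card_mfact (m : 'I_(mboxes N)) : #|mfact m| <= n ^ k.+1.
Proof.
rewrite card_tagged; apply: leq_trans (@sumn_le _ _ _ (n ^ k) _) _ => [r|].
  apply: leq_trans (card_tuples m _) _; apply: leq_pexp2l (sz_gt0 _) _.
  exact: arity.
by rewrite size_enum_ord expnS; apply: leq_mul => //; apply: nrel_le.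
Qed.

(** A fact is a middlebox, a relation and at most [k] components; a channel item is two nodes and
    the three components of a packet; the successor counts abort. Bounded arity enters here. *)
Lemma card_item : #|item N| <= (n ^ k.+2 + n ^ 5).+1.
Proof.
have hm := hosts_mboxes_le; have ht := tags_le.
rewrite card_option ltnS card_sum; apply: leq_add.
  rewrite card_tagged; apply: leq_trans (@sumn_le _ _ _ (n ^ k.+1) _) _ => [m|].
    exact: card_mfact.
  rewrite size_enum_ord [n ^ k.+2]expnS; apply: leq_mul => //; lia.
rewrite !card_prod !card_sum !card_ord (_ : n ^ 5 = n * n * (n * n * n)); last first.
  by rewrite !expnS expn0 !mulnA muln1.
by do !apply: leq_mul => //; lia.
Qed.

Lemma sz_tnode (v : node N) : sz (tnode v) <= 2 * n + 5.
Proof.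
have hm := hosts_mboxes_le.
case: v => i /=; have := ltn_ord i; rewrite !sz_Cons ?sz_tnat -?[sz Leaf]/1; lia.
Qed.

Lemma sz_tdom (m : 'I_(mboxes N)) s (d : dom (hosts N) (tags N) (port m) s) :
  sz (tdom (@tport N m) d) <= 2 * n + 5.
Proof.
have hm := hosts_mboxes_le; have ht := tags_le.
case: s d => /= d; first by rewrite sz_tnat; have := ltn_ord d; lia.
  exact: sz_tnode.
by rewrite sz_tnat; have := ltn_ord d; lia.
Qed.

Lemma sz_ttuple (m : 'I_(mboxes N)) sg (t : tuples (hosts N) (tags N) (port m) sg) :
  sz (ttuple (@tport N m) t) <= size sg * (2 * n + 6) + 1.
Proof.
elim: sg t => [|s sg IH] t //=.
by rewrite sz_Cons mulSn; have := IH t.2; have := sz_tdom t.1; lia.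
Qed.

Lemma sz_code (it : item N) : sz (code it) <= (k + 10) * (2 * n + 6).
Proof.
have hm := hosts_mboxes_le; have ht := tags_le.
have hr (m : 'I_(mboxes N)) (r : 'I_(nrel (mbox m))) : r < n :=
  leq_trans (ltn_ord r) (nrel_le m).
have hv := sz_tnode; have tu := sz_ttuple.
move: n hm ht hr hv tu => n hm ht hr hv tu.
case: it => [[[m [r t]]|[[u v] p]]|] /=.
- have hm' : (m : nat) < n by apply: leq_trans (ltn_ord m) _; lia.
  have ar : size (signature r) * (2 * n + 6) <= k * (2 * n + 6).
    by rewrite leq_mul2r arity orbT.
  have ht' := leq_trans (tu _ _ t) (leq_add ar (leqnn 1)).
  rewrite !sz_Cons -[sz Leaf]/1 !sz_tnat mulnDl.
  have arith T a i j : T <= a + 1 -> i < n -> j < n ->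
    (1 + (i.*2.+1 + (j.*2.+1 + T).+1).+1).+1 <= a + 10 * (2 * n + 6) by lia.
  exact: arith ht' hm' (hr m r).
- case: p => [[a b] c]; rewrite /tpacket /tlist /= !sz_Cons -[sz Leaf]/1 !sz_tnat /= mulnDl.
  have := hv u; have := hv v.
  by have := ltn_ord a; have := ltn_ord b; have := ltn_ord c; lia.
by rewrite -[sz Leaf]/1; lia.
Qed.

Lemma sz_state (ks : seq (item N)) : size ks <= #|item N| ->
  sz (Cons (tseq (@code N) ks) (tnetwork N)) <=
  2 + (n ^ k.+2 + n ^ 5).+1 * ((k + 10) * (2 * n + 6) + 1) + n.
Proof.
move=> le; rewrite sz_Cons.
have arith s x y z : s <= 1 + x -> x <= y -> (s + z).+1 <= 2 + y + z by lia.
apply: arith (leq_mul (leq_trans le card_item) (leqnn _)).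
elim: ks {le} => // it ks IH; rewrite [tseq _ _]/= sz_Cons [size _]/= mulSn.
have step s t a b : s <= a -> t <= 1 + b -> (s + t).+1 <= 1 + (a + 1 + b) by lia.
exact: step (sz_code it) IH.
Qed.

End Counting.

(** * The machine *)

(** A total function standing for the loop: the number of rounds is searched up to [B x], whereas
    the machine simply runs until the test fails. *)
Definition whileT (B : tree -> nat) (c step : tree -> tree) (x : tree) : tree :=
  iter (find (fun i => ~~ truth (c (iter i step x))) (iota 0 (B x).+1)) step x.

Lemma whileTE B (c step : tree -> tree) x n :
  n <= B x -> c (iter n step x) = Leaf ->
  (forall i, i < n -> c (iter i step x) <> Leaf) -> whileT B c step x = iter n step x.
Proof.
move=> nB cn cN; rewrite /whileT; congr iter.
have -> : (B x).+1 = n + (B x - n).+1 by lia.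
rewrite iotaD find_cat size_iota ifN.
  by rewrite /= cn addn0.
by apply/hasPn => i; rewrite mem_iota => /cN; case: (c _).
Qed.

Definition bound (k : nat) (x : tree) : nat := (sz x ^ k.+2 + sz x ^ 5).+1.

Definition saturateT (k : nat) : tree -> tree := whileT (bound k) pending roundT.

Definition decideT (k : nat) (net : tree) : tree :=
  ift (memT Leaf (hd (saturateT k (Cons Leaf net)))) Leaf yesT.

Definition instance (k : nat) (N : network) : Prop :=
  syntactically_increasing N /\ arity_at_most k N.

Lemma bound_card k N : arity_at_most k N ->
  #|item N| <= bound k (Cons Leaf (tnetwork N)).
Proof.
move=> ar; apply: leq_trans (card_item ar) _; rewrite ltnS.
have le : sz (tnetwork N) <= sz (Cons Leaf (tnetwork N)) by rewrite sz_Cons; lia.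
by apply: leq_add; apply: leq_pow_mono.
Qed.

Lemma good_nil N : good (@nil (item N)).
Proof. by split=> //; constructor. Qed.

(** On encodings of admissible networks every intermediate state is a duplicate-free list of item
    codes, which bounds both rounds and sizes. *)
Lemma FPon_saturateT k :
  FPon (fun x => exists2 N, instance k N & x = Cons Leaf (tnetwork N)) (saturateT k).
Proof.
pose B x := 2 + (sz x ^ k.+2 + sz x ^ 5 + 1) * ((k + 10) * (2 * sz x + 6) + 1) + sz x.
apply: (@FPon_while _ pending roundT _ (bound k) B).
- exact: FP2_freshT.
- exact: FP_roundT.
- by apply: (@pb_le _ (fun x => sz x ^ k.+2 + sz x ^ 5 + 1)) => [|x _];
    [pb | rewrite addn1].
- by rewrite /B; pb.
move=> _ [N [_ ar] ->].
have [n [ks [h1 h2 h3 [h4 _] h5]]] := loop_ends (good_nil N).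
rewrite add0n in h1; rewrite -[tseq _ [::]]/Leaf in h2 h5.
have nB := leq_trans h1 (bound_card ar).
exists n; have Es : saturateT k (Cons Leaf (tnetwork N)) = iter n roundT (Cons Leaf (tnetwork N)).
  by apply: whileTE => // [|i /h5[]//]; rewrite h2.
split=> //; first by rewrite Es h2.
  by move=> i /h5[].
move=> i le.
have [ks0 g ->] : exists2 ks0, good ks0 &
    iter i roundT (Cons Leaf (tnetwork N)) = Cons (tseq (@code N) ks0) (tnetwork N).
  by move: le; rewrite leq_eqVlt => /orP[/eqP->|/h5[] //]; exists ks.
apply: leq_trans (sz_state ar (good_size g)) _; rewrite /B.
have : sz (tnetwork N) <= sz (Cons Leaf (tnetwork N)) by rewrite sz_Cons; lia.
move: (sz (tnetwork N)) (sz (Cons _ _)) => a b le'.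
apply: leq_add => //; rewrite leq_add2l; apply: leq_mul.
  by rewrite addn1 ltnS; apply: leq_add; apply: leq_pow_mono.
by rewrite leq_add2r; apply: leq_mul => //; lia.
Qed.

Lemma FPon_decideT k :
  FPon (fun x => exists2 N, instance k N & x = tnetwork N) (decideT k).
Proof.
have Ha : FP (fun net => Cons Leaf net) by fp.
have Hc : FP (fun y => ift (memT Leaf (hd y)) Leaf yesT).
  apply: FP_ift; [|exact: FP_const..].
  by apply: (FP2_comp FP2_memT); fp.
have H : FPon (fun x => exists2 N, instance k N & x = tnetwork N)
    (fun net => saturateT k (Cons Leaf net)).
  case: Ha => [[D s] [F [h [[D' b] sp]]]].
  apply: (FPon_comp _ (FPon_saturateT k)); last by move=> _ [N HN ->]; exists N.
  split; first by exists D => x _; apply: s.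
  exists F, h; split; first by exists D' => x _; apply: b.
  by move=> x _; apply: sp.
exact: (FPon_comp H Hc).
Qed.

Lemma decideT_correct k N : instance k N ->
  truth (decideT k (tnetwork N)) <-> safe N.
Proof.
move=> [inc ar].
have [n [ks [h1 h2 [U A G] [h4 closed] h5]]] := loop_ends (good_nil N).
rewrite add0n in h1; rewrite -[tseq _ [::]]/Leaf in h2 h5.
have nB := leq_trans h1 (bound_card ar).
have Es : saturateT k (Cons Leaf (tnetwork N)) = Cons (tseq (@code N) ks) (tnetwork N).
  by rewrite -h2; apply: whileTE => // [|i /h5[]//]; rewrite h2.
rewrite /decideT Es truth_ift.
case: memTP => /= [/(inT_code ks (abortI N)) H|H].
  by split=> // S; have := generated_no_abort inc S G; rewrite H.
split=> // _; apply: (saturated_safe inc closed).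
by apply/negP => H'; apply: H; apply/(inT_code ks (abortI N)).
Qed.

Section Machine.

Variable F : frag.

(** After the fragment exits, [inr None] spends one step reading the first bit of the result, which
    is [true] exactly for a [Cons]. *)
Definition machine : TM :=
  @MkTM 3 unit (fctl F + option bool)%type (inl (fentry F))
    (fun q => if q is inr b then b else None)
    (fun q r => match q with
     | inl q => let: (o, a) := fdelta q r in
                (if o is Some q' then inl q' else inr None, a)
     | inr b => (inr (Some (r ord0 == Some (inl true))), keep r)
     end).

Lemma machine_runs q T n T' :
  runs q T n T' -> iter n (@tm_step machine) (inl q, T) = (inr None, T').
Proof.
elim=> {q T n T'} [q T a E|q q' T a n T' E _ IH]; last rewrite iterSr.
  by rewrite /= /tm_step /= -/(scan T) E.
by rewrite -IH /tm_step /= -/(scan T) E.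
Qed.

Lemma tm_step_halt (c : tm_config machine) n b :
  verdict c.1 = Some b -> iter n (@tm_step machine) c = c.
Proof. by move=> E; elim: n => //= n ->; rewrite /tm_step E. Qed.

Lemma machine_answer w b s t t' :
  spec F (main w) (main (b :: s)) t -> t < t' -> tm_answer machine w t' = Some b.
Proof.
move=> sp lt; have [|T' [n [le r R]]] := spec_run sp (T := (tm_init machine w).2).
  move=> i; rewrite /= ffunE; case: i => -[|[|[|[|//]]]] lti; rewrite /stk /=.
  - split=> [j|[]//]; set l := [seq _ | _ <- w].
    by case: l j => [|a l] [|[|j]].
  1-3: by split=> -[|[|]].
(* The fragment takes [n] steps, reading the answer takes one, and the halted machine idles for the
   rest. *)
have -> : t' = (t' - n.+1) + (1 + n) by lia.
rewrite /tm_answer iterD [iter (1 + n) _ _]iterD.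
have -> : tm_init machine w = (inl (fentry F), (tm_init machine w).2) by [].
rewrite (machine_runs r) (@tm_step_halt _ _ b) //=.
all: have [/(_ 0) /= E _] := R ord0; rewrite !ffunE E /=; by case: (b).
Qed.

End Machine.

Theorem theorem2 (k : nat) :
  PTIME_decidable encode
    (fun N : network => syntactically_increasing N /\ arity_at_most k N)
    safe.
Proof.
have [_ [F [h [[D Hh] sp]]]] := FPon_decideT k.
(* The fragment takes at most [n.+1 ^ D] steps on input length [n]; as [n] is positive this is at
   most [2 ^ D * n ^ D], and the summand 1 leaves time to read the answer. *)
exists (machine F), (2 ^ D + 1), D => N HN.
have PN : exists2 N', instance k N' & tnetwork N = tnetwork N' by exists N.
exists (truth (decideT k (tnetwork N))); split; last exact: decideT_correct.
have [s Es] : exists s, bits (decideT k (tnetwork N)) =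
    truth (decideT k (tnetwork N)) :: s.
  by case: decideT => [|a b] /=; eexists.
have := sp _ PN [::]; rewrite !cats0 Es => H.
apply: (machine_answer H); apply: leq_ltn_trans (Hh _ PN) _.
rewrite -/(sz (tnetwork N)).
have := sz_gt0 (tnetwork N); move: (sz _) => n n0.
apply: (@leq_ltn_trans ((2 * n) ^ D)); first by apply: leq_pow_mono; lia.
by rewrite expnMn mulnDl; lia.
Qed.
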